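(* Let $G$ be a metric graph and let $Z:G\to\mathbb R$ be a square-integrable process such that $Z\in C_k^m(x)$, where $x\in G$ and $1\le k\le m\le\infty$. Let $\psi:[0,+\infty)\to\mathbb R$ be a non-constant completely monotonic function such that $\psi^{(m)}(0^+)$ is finite (if $m=+\infty$, this means that $\psi^{(j)}(0^+)$ is finite for all $j\in\mathbb N$). If $Y:=\mathcal{S}ch_\psi(Z)$, then $Y\in C_1^m(x)$.
   Context: A metric graph $G=(V,E)$ has a finite vertex set $V$ and a finite edge set $E$; each edge $e\in E$ has a length $0<l_e<\infty$ and is identified with the segment $[0,l_e]$, edges being glued at their common endpoints (the vertices). $G$ also denotes the set of all points on the edges (vertices included). Throughout, $G$ is connected and simple (no self-loops, no multiple edges). For $x\in G$, $E_x$ is the set of edges stemming from $x$ (if $x$ is interior to an edge $(v_1,v_2)$, these are the two segments from $x$ to $v_1$ and from $x$ to $v_2$). The exiting directional derivative is $\partial_e f(x):=\lim_{h\to0^+}\frac{f(x+he)-f(x)}{h}$, where $x+he$ is the point of $e$ at shortest-path distance $h$ from $x$; $\partial_e^i$ is the $i$-th order exiting derivative; for processes limits are in the mean-square sense. For $0\le j\le m\le\infty$, a stochastic process on $G$ is in $C_j^m(G)$ if its restriction to each edge has continuous $m$-order derivative in the mean-square sense and at each vertex $v$ the Kirchhoff conditions of every (finite) order $i\le j$ hold almost surely: if $i$ is even, all exiting derivatives $\partial_e^i Z(v)$, $e\in E_v$, are equal; if $i$ is odd, $\sum_{e\in E_v}\partial_e^i Z(v)=0$. A process is in $C_j^m(x)$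 if these conditions hold at the point $x\in G$ (i.e. edge-wise mean-square $C^m$ regularity at $x$ and, if $x$ is a vertex, the Kirchhoff conditions at $x$ up to order $j$). For a square-integrable process $Z$ with variogram $\gamma_Z(x_1,x_2):=\mathrm{Var}(Z(x_1)-Z(x_2))$, $\mathcal{S}ch_\psi(Z)$ denotes the (unique in law) centred Gaussian process with covariance function $C_Y(x_1,x_2):=\psi(\gamma_Z(x_1,x_2))$ (positive definite by Schoenberg's theorem). A completely monotonic function $\psi:[0,+\infty)\to\mathbb R$ is continuous on $[0,\infty)$ (so $\psi(0)<\infty$), infinitely differentiable on $(0,\infty)$, with $(-1)^k\psi^{(k)}\ge0$ on $(0,\infty)$ for all $k\ge0$. *)

(* Defs.v *)
From HB Require Import structures.
From mathcomp Require Import all_boot all_order all_algebra.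
From mathcomp Require Import all_classical all_reals all_analysis.

Set Implicit Arguments.
Unset Strict Implicit.
Unset Printing Implicit Defensive.

Import Order.TTheory GRing.Theory Num.Theory.
Import numFieldNormedType.Exports.

Local Open Scope classical_set_scope.
Local Open Scope ring_scope.

(* Differentiability orders, possibly infinite. *)
Inductive enat := Fin of nat | Infty.

Definition le_enat (a b : enat) : bool :=
  match a, b with
  | _, Infty => true
  | Fin i, Fin j => (i <= j)%N
  | Infty, Fin _ => false
  end.

(* The identification of an edge e with [0, len e] orients e from src e
   (parameter 0) to tgt e (parameter len e). *)
Record metric_graph (R : realType) := MetricGraph {
  vertex : finType;
  edge : finType;
  src : edge -> vertex;
  tgt : edge -> vertex;
  len : edge -> R;
  len_gt0 : forall e, 0 < len e;
  no_loop : forall e, src e != tgt e;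
  no_multi_edge : forall e e',
    (src e == src e') && (tgt e == tgt e')
    || (src e == tgt e') && (tgt e == src e') -> e = e';
  connected_graph : forall u v,
    connect [rel a b | [exists e, (src e == a) && (tgt e == b)
                               || (src e == b) && (tgt e == a)]] u v
}.

(* Gluing the edges at their endpoints leaves the vertices together with the
   points of the open edges. *)
Inductive gpoint (R : realType) (G : metric_graph R) :=
  | Vertex of vertex G
  | Interior (e : edge G) (t : R) of 0 < t < len e.
Arguments Vertex {R G} _.
Arguments Interior {R G} e t _.

(* The point of e with parameter t, meaningful for 0 <= t <= len e. *)
Definition epoint (R : realType) (G : metric_graph R) (e : edge G) (t : R) :
    gpoint G :=
  match @idP (0 < t < len e) with
  | ReflectT h => Interior e t h
  | ReflectF _ => if t <= 0 then Vertex (src e) else Vertex (tgt e)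
  end.

(* (e, true) travels along e from src e to tgt e, (e, false) backwards. *)
Definition dir (R : realType) (G : metric_graph R) : finType :=
  (edge G * bool)%type.

(* The set E_x. *)
Definition stems (R : realType) (G : metric_graph R) (x : gpoint G)
    (d : dir G) : bool :=
  match x with
  | Vertex v => (if d.2 then src d.1 else tgt d.1) == v
  | Interior e _ _ => d.1 == e
  end.

(* The parameter of x on the edge of d, when d stems from x. *)
Definition param (R : realType) (G : metric_graph R) (d : dir G)
    (x : gpoint G) : R :=
  match x with
  | Vertex _ => if d.2 then 0 else len d.1
  | Interior _ t _ => t
  end.

(* x + h d; for small h > 0, distance along the edge is shortest-path
   distance. *)
Definition along (R : realType) (G : metric_graph R) (d : dir G)
    (x : gpoint G) (h : R) : gpoint G :=
  epoint d.1 (if d.2 then param d x + h else param d x - h).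

Section MeanSquare.
Context (R : realType) (disp : measure_display) (T : measurableType disp)
  (P : probability T R).

Definition ms_cvg (I : Type) (F : set_system I) (X : I -> T -> R)
    (L : T -> R) : Prop :=
  [/\ \forall i \near F, X i \in Lfun P 2%:E,
      L \in Lfun P 2%:E &
      ('E_P[fun w => ((X i w - L w) ^+ 2)%R])%E @[i --> F] --> 0%E].

Definition ms_continuous_on (A : set R) (f : R -> T -> R) : Prop :=
  forall t, A t -> ms_cvg (within A (nbhs t)) f (f t).

Definition ms_deriv_on (A : set R) (f g : R -> T -> R) : Prop :=
  forall t, A t ->
    ms_cvg (within A t^') (fun s w => (f s w - f t w) / (s - t)) (g t).

(* Only meaningful on intervals A with nonempty interior. *)
Fixpoint ms_Cn_on (n : nat) (A : set R) (f : R -> T -> R) : Prop :=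
  if n is n'.+1 then
    exists2 g : R -> T -> R, ms_deriv_on A f g & ms_Cn_on n' A g
  else ms_continuous_on A f.

Context (G : metric_graph R).
Implicit Types (Z : gpoint G -> T -> R) (x : gpoint G) (d : dir G).

(* W is (a version of) the i-th order exiting derivative of Z at x in the
   direction d; V h is the i-th order derivative at x + h d. *)
Fixpoint exit_deriv (i : nat) d Z x (W : T -> R) : Prop :=
  if i is i'.+1 then
    exists V : R -> T -> R,
      [/\ exit_deriv i' d Z x (V 0),
          \forall h \near 0^'+, exit_deriv i' d Z (along d x h) (V h) &
          ms_cvg 0^'+ (fun h w => (V h w - V 0 w) / h) W]
  else W = Z x.

Definition Kirchhoff_at (i : nat) Z x : Prop :=
  exists W : dir G -> T -> R,
    (forall d, stems x d -> exit_deriv i d Z x (W d)) /\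
    if odd i then {ae P, forall w, \sum_(d | stems x d) W d w = 0}
    else {ae P, forall w, forall d1 d2,
           stems x d1 -> stems x d2 -> W d1 w = W d2 w}.

(* C^n on the part of each closed edge through x lying in a neighbourhood
   of x. *)
Definition edgewise_Cn_at (n : nat) Z x : Prop :=
  forall d, stems x d ->
    exists2 r : R, 0 < r &
      ms_Cn_on n [set t | 0 <= t <= len d.1 /\ `|t - param d x| < r]
        (fun t => Z (epoint d.1 t)).

Definition is_vertex x : Prop :=
  if x is Vertex _ then True else False.

(* Z \in C_j^m(x) *)
Definition C_at (j m : enat) Z x : Prop :=
  (forall n : nat, le_enat (Fin n) m -> edgewise_Cn_at n Z x) /\
  (is_vertex x ->
   forall i : nat, le_enat (Fin i) j -> Kirchhoff_at i Z x).

Definition square_integrable (I : Type) (X : I -> T -> R) : Prop :=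
  forall i, X i \in Lfun P 2%:E.

Definition variogram (I : Type) (X : I -> T -> R) (i1 i2 : I) : R :=
  fine ('V_P[fun w => (X i1 w - X i2 w)%R])%E.

(* Normal law, including the degenerate one of zero variance. *)
Definition gaussian_rv (X : T -> R) : Prop :=
  measurable_fun setT X /\
  exists m s : R, forall A : set R, measurable A ->
    P (X @^-1` A) = if s == 0 then \d_m A else normal_prob m s A.

Definition gaussian_process (I : Type) (X : I -> T -> R) : Prop :=
  forall (n : nat) (a : 'I_n -> R) (p : 'I_n -> I),
    gaussian_rv (fun w => \sum_(i < n) a i * X (p i) w).

End MeanSquare.

(* Y has the law of Sch_psi(Z); Y may live on another probability space. *)
Definition is_Sch (R : realType) (d d' : measure_display)
    (T : measurableType d) (P : probability T R)
    (T' : measurableType d') (P' : probability T' R) (I : Type)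
    (psi : R -> R) (Z : I -> T -> R) (Y : I -> T' -> R) : Prop :=
  [/\ gaussian_process P' Y,
      forall x, ('E_P'[Y x] = 0)%E &
      forall x1 x2, covariance P' (Y x1) (Y x2)
                    = (psi (variogram P Z x1 x2))%:E].

(* The values of psi on the negative reals are irrelevant. *)
Definition completely_monotone (R : realType) (psi : R -> R) : Prop :=
  {within `[0, +oo[, continuous psi} /\
  forall (k : nat) (t : R), 0 < t ->
    derivable (derive1n k psi) t 1 /\ 0 <= (-1) ^+ k * derive1n k psi t.

Definition nonconstant (R : realType) (psi : R -> R) : Prop :=
  exists s t : R, [/\ 0 <= s, 0 <= t & psi s != psi t].

(* psi^(m)(0^+) is finite; for m = oo, all the psi^(j)(0^+) are. *)
Definition finite_deriv0 (R : realType) (psi : R -> R) (m : enat) : Prop :=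
  let fin_at n := exists l : R, derive1n n psi t @[t --> 0^'+] --> l in
  match m with
  | Fin n => fin_at n
  | Infty => forall n, fin_at n
  end.

(* Main.v *)
Require Import Defs.
From mathcomp Require Import all_boot all_order all_algebra.
From mathcomp Require Import all_classical all_reals all_analysis.
From mathcomp Require Import measurable_realfun.
From mathcomp Require Import ring lra zify.

Set Implicit Arguments.
Unset Strict Implicit.
Unset Printing Implicit Defensive.

Import Order.TTheory GRing.Theory Num.Theory.
Import numFieldNormedType.Exports.

Local Open Scope classical_set_scope.
Local Open Scope ring_scope.

(* Center Z, so that gamma (s, t) = |Z_s - Z_t| ^ 2 in L2, and work on an interval
   of one edge. The kernel of Y is psi (gamma (s, t)), and Y is mean-square C^n as
   soon as the kernel has mixed derivatives up to order (n, n). Only n derivatives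
   of psi are bounded at 0, but every derivative of psi of order k > n is
   multiplied by first derivatives of gamma, which are O(sqrt gamma), and
   u ^ (k - n) psi^(k) (u) tends to 0 at 0+ by monotonicity of psi^(k). To avoid
   differentiating at the zeros of gamma, psi (gamma) is replaced by
   psi (gamma + e), and e tends to 0 jointly with (s, t).
   At a vertex the exiting derivatives satisfy
   E[Y_d' Y_e'] = - 2 psi'(0+) Cov (Z_d', Z_e'), so that E[(sum_d Y_d') ^ 2] is a
   multiple of Var (sum_d Z_d') = 0. *)

(** * The inner product of square-integrable variables *)

(** At order (n, n), a term with psi^(n + j) carries n + j derivatives of gamma of total order 2 n,
    so at least 2 j of them are of order one. Each of these is O(sqrt gamma), hence their product is
    O(gamma ^ j), which is what u ^ j psi^(n + j) (u) -> 0 compensates. The rectangles of parameters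
    on which the kernel is differenced may cross the zeros of gamma, in particular the diagonal. For
    e > 0 such a rectangle increment is a mixed derivative at some intermediate point. That point
    moves with e, and only its distance to (s, t) is controlled, so a limit in e at fixed parameters
    would not be enough: this is why e and (s, t) tend to their limits jointly. *)

Section InnerProduct.
Context (R : realType) (disp : measure_display) (T : measurableType disp)
  (P : probability T R).
Implicit Types (f g h : T -> R) (c : R).

Local Notation L2 := (Lfun P 2%:E).

Definition ip f g : R := fine 'E_P[f * g]%E.

Lemma L2_measurable f : f \in L2 -> measurable_fun setT f.
Proof. by rewrite inE => /andP[]; rewrite inE. Qed.

Lemma L2_mul f g : f \in L2 -> g \in L2 -> f * g \in Lfun P 1.
Proof. exact: Lfun2_mul_Lfun1. Qed.

Lemma L2D f g : f \in L2 -> g \in L2 -> f + g \in L2.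
Proof. by move=> ? ?; rewrite rpredD// lee1n. Qed.

Lemma L2N f : f \in L2 -> - f \in L2.
Proof. by move=> ?; rewrite rpredN// lee1n. Qed.

Lemma L2B f g : f \in L2 -> g \in L2 -> f - g \in L2.
Proof. by move=> ? ?; rewrite rpredB// lee1n. Qed.

Lemma L2Z c f : f \in L2 -> c *: f \in L2.
Proof. by move=> ?; rewrite rpredZ// lee1n. Qed.

Lemma L2_0 : (0 : T -> R) \in L2.
Proof. exact: (Lfun_cst P 0). Qed.

Lemma L2_sum (I : Type) (r : seq I) (Q : pred I) (F : I -> T -> R) :
  (forall i, Q i -> F i \in L2) -> \sum_(i <- r | Q i) F i \in L2.
Proof.
move=> FL; elim: r => [|i r IH]; first by rewrite big_nil L2_0.
by rewrite big_cons; case: ifP => // Qi; rewrite L2D// FL.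
Qed.

Lemma ipE f g : f \in L2 -> g \in L2 -> ('E_P[f * g])%E = (ip f g)%:E.
Proof. by move=> ? ?; rewrite /ip fineK// expectation_fin_num// L2_mul. Qed.

Lemma L2_sqr_lty f : measurable_fun setT f ->
  ('E_P[f * f] < +oo)%E -> f \in L2.
Proof.
move=> mf fy; rewrite inE; apply/andP; split; rewrite inE//=.
rewrite /finite_norm unlock /Lnorm poweR_lty//.
move: fy; rewrite unlock; congr (_ < _)%E; apply: eq_integral => w _ /=.
by rewrite powR_mulrn ?normr_ge0// -normrX ger0_norm ?sqr_ge0// expr2.
Qed.

Lemma ipC f g : ip f g = ip g f.
Proof. by rewrite /ip mulrC. Qed.

Lemma ip0l g : ip 0 g = 0.
Proof. by rewrite /ip mul0r (_ : 0 = cst 0)// expectation_cst. Qed.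

Lemma ip0r f : ip f 0 = 0.
Proof. by rewrite ipC ip0l. Qed.

Lemma ipDl f g h : f \in L2 -> g \in L2 -> h \in L2 ->
  ip (f + g) h = ip f h + ip g h.
Proof.
move=> fL gL hL; apply: EFin_inj; rewrite -ipE ?L2D// mulrDl.
by rewrite expectationD ?L2_mul// !ipE.
Qed.

Lemma ipZl c f g : f \in L2 -> g \in L2 -> ip (c *: f) g = c * ip f g.
Proof.
move=> fL gL; apply: EFin_inj; rewrite -ipE ?L2Z//.
rewrite (_ : (c *: f) * g = c \o* (f * g)); last first.
  by apply/funext => w; rewrite -[LHS]/(c * f w * g w) -[RHS]/(f w * g w * c); ring.
by rewrite expectationZl ?L2_mul// ipE.
Qed.

Lemma ipNl f g : f \in L2 -> g \in L2 -> ip (- f) g = - ip f g.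
Proof. by move=> fL gL; rewrite -scaleN1r ipZl// mulN1r. Qed.

Lemma ipBl f g h : f \in L2 -> g \in L2 -> h \in L2 ->
  ip (f - g) h = ip f h - ip g h.
Proof. by move=> fL gL hL; rewrite ipDl ?L2N// ipNl. Qed.

Lemma ipDr f g h : f \in L2 -> g \in L2 -> h \in L2 ->
  ip h (f + g) = ip h f + ip h g.
Proof. by move=> fL gL hL; rewrite ipC ipDl// !(ipC h). Qed.

Lemma ipZr c f g : f \in L2 -> g \in L2 -> ip f (c *: g) = c * ip f g.
Proof. by move=> fL gL; rewrite ipC ipZl// ipC. Qed.

Lemma ip_scale c f : f \in L2 -> ip (c *: f) (c *: f) = c ^+ 2 * ip f f.
Proof. by move=> fL; rewrite ipZl ?ipZr ?L2Z// mulrA. Qed.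

Lemma ipBr f g h : f \in L2 -> g \in L2 -> h \in L2 ->
  ip h (f - g) = ip h f - ip h g.
Proof. by move=> fL gL hL; rewrite ipC ipBl// !(ipC h). Qed.

Lemma ip_sum_sum (I : finType) (Q : pred I) (f : I -> T -> R) :
  (forall i, Q i -> f i \in L2) ->
  ip (\sum_(i | Q i) f i) (\sum_(i | Q i) f i) =
  \sum_(i | Q i) \sum_(j | Q j) ip (f i) (f j).
Proof.
move=> fL; have SL : \sum_(i | Q i) f i \in L2 by rewrite L2_sum.
set S := (X in ip _ X); have {}SL : S \in L2 by [].
have -> : forall (r : seq I), ip (\sum_(i <- r | Q i) f i) S
    = \sum_(i <- r | Q i) ip (f i) S.
  elim=> [|i r IH]; first by rewrite !big_nil ip0l.
  rewrite !big_cons; case: ifP => // Qi.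
  by rewrite ipDl ?fL ?L2_sum// IH.
apply: eq_bigr => i Qi; rewrite /S.
elim: (index_enum I) => [|j r IH]; first by rewrite !big_nil ip0r.
rewrite !big_cons; case: ifP => // Qj.
by rewrite ipDr ?fL ?L2_sum// IH.
Qed.

Lemma ip_ge0 f : 0 <= ip f f.
Proof.
by rewrite /ip fine_ge0// expectation_ge0// => w; rewrite -expr2 sqr_ge0.
Qed.

Lemma ip_cauchy_schwarz f g : f \in L2 -> g \in L2 ->
  ip f g ^+ 2 <= ip f f * ip g g.
Proof.
move=> fL gL.
have key c : 0 <= ip f f + c * ip f g *+ 2 + c ^+ 2 * ip g g.
  have := ip_ge0 (f + c *: g).
  rewrite !(ipDl, ipDr) ?L2Z ?L2D ?L2Z//.
  rewrite !(ipZl, ipZr) ?L2Z//.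
  by rewrite (ipC g f); congr (_ <= _); ring.
have [g0|g0] := eqVneq (ip g g) 0; last first.
  have gp : 0 < ip g g by rewrite lt_def g0 ip_ge0.
  have := mulr_ge0 (key (- (ip f g / ip g g))) (ltW gp).
  by rewrite -(subr_ge0 (ip f g ^+ 2)); congr (_ <= _); field.
rewrite g0 mulr0; have [->|fg0] := eqVneq (ip f g) 0; first by rewrite expr0n.
(* With [ip g g = 0] the quadratic is affine in c, and this c gives it the negative value - [ip f f]
   - 2. *)
have := key (- (ip f f + 1) / (ip f g)).
rewrite g0 mulr0 addr0 divfK// => ?.
have := ip_ge0 f; lra.
Qed.

Lemma ip_norm_le f g : f \in L2 -> g \in L2 ->
  `|ip f g| <= Num.sqrt (ip f f) * Num.sqrt (ip g g).
Proof.
move=> fL gL; rewrite -sqrtrM ?ip_ge0// -sqrtr_sqr.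
by rewrite ler_wsqrtr// ip_cauchy_schwarz.
Qed.

Lemma ip_add_le f g : f \in L2 -> g \in L2 ->
  ip (f + g) (f + g) <= 2 * ip f f + 2 * ip g g.
Proof.
move=> fL gL; have := ip_ge0 (f - g).
rewrite !(ipBl, ipBr, ipDl, ipDr) ?L2B ?L2D//.
by rewrite (ipC g f); lra.
Qed.

Lemma ip_distC f g : ip (f - g) (f - g) = ip (g - f) (g - f).
Proof. by rewrite /ip -(opprB g f) mulrNN. Qed.

Lemma ip_sub_le f g h : f \in L2 -> g \in L2 -> h \in L2 ->
  ip (f - h) (f - h) <= 2 * ip (f - g) (f - g) + 2 * ip (g - h) (g - h).
Proof.
move=> fL gL hL; rewrite -(subrK g f) -(addrA _ g) addrK.
by apply: ip_add_le; rewrite L2B.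
Qed.

Lemma ip_eq0_ae f : f \in L2 -> ip f f = 0 -> {ae P, forall w, f w = 0}.
Proof.
move=> fL f0; have mf := L2_measurable fL.
have : (\int[P]_(w in setT) `|(f w * f w)%:E| = 0)%E.
  transitivity ('E_P[f * f])%E; last by rewrite ipE// f0.
  rewrite unlock; apply: eq_integral => w _.
  by rewrite gee0_abs// lee_fin -expr2 sqr_ge0.
move/(ae_eq_integral_abs P measurableT) => H.
apply: filterS (H _); last first.
  by apply/measurable_EFinP; exact: measurable_funM.
move => w /(_ I) /= [] /eqP; rewrite mulf_eq0 => /orP[] /eqP //.
Qed.

Lemma ip_ae0 f g : f \in L2 -> g \in L2 ->
  {ae P, forall w, f w = 0} -> ip f g = 0.
Proof.
move=> fL gL f0; rewrite /ip unlock.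
have mf := L2_measurable fL; have mg := L2_measurable gL.
rewrite (ae_eq_integral (cst 0%E))//.
- by rewrite integral0.
- by apply/measurable_EFinP; exact: measurable_funM.
- by apply: filterS f0 => w /= fw0 _; rewrite fctE fw0 mul0r.
Qed.

End InnerProduct.

(** * Limits in L2 along a filter *)

Section MeanSquareLimits.
Context (R : realType) (disp : measure_display) (T : measurableType disp)
  (P : probability T R).

Local Notation L2 := (Lfun P 2%:E).
Local Notation ip := (ip P).

Lemma ms_cvgP (I : Type) (F : set_system I) {FF : Filter F}
    (X : I -> T -> R) (L : T -> R) :
  ms_cvg P F X L <->
  [/\ \forall i \near F, X i \in L2, L \in L2 &
      ip (X i - L) (X i - L) @[i --> F] --> 0].
Proof.
have E i : ('E_P[fun w => ((X i w - L w) ^+ 2)%R])%E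
    = ('E_P[(X i - L) * (X i - L)])%E.
  by congr expectation; apply/funext => w; rewrite expr2.
split=> -[XL LL cv]; split=> //.
- move: cv; under eq_fun do rewrite E.
  by move/fine_cvgP => [_].
- under eq_fun do rewrite E.
  apply/fine_cvgP; split=> //.
  near=> i; rewrite ipE ?L2B//; near: i; exact: XL.
Unshelve. all: by end_near. Qed.

Lemma ms_cvg_ip (I : Type) (F : set_system I) {FF : Filter F}
    (X Y : I -> T -> R) (L M : T -> R) :
  ms_cvg P F X L -> ms_cvg P F Y M ->
  ip (X i) (Y i) @[i --> F] --> ip L M.
Proof.
move=> /ms_cvgP[XL LL cvX] /ms_cvgP[YL ML cvY].
have cs : Num.sqrt (ip (X i - L) (X i - L)) @[i --> F] --> 0.
  rewrite -(@sqrtr0 R); apply: (cvg_comp _ _ cvX); exact: sqrt_continuous.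
have ct : Num.sqrt (ip (Y i - M) (Y i - M)) @[i --> F] --> 0.
  rewrite -(@sqrtr0 R); apply: (cvg_comp _ _ cvY); exact: sqrt_continuous.
apply/subr_cvg0.
pose b i := Num.sqrt (ip (X i - L) (X i - L)) *
   (Num.sqrt (ip (Y i - M) (Y i - M)) + Num.sqrt (ip M M))
   + Num.sqrt (ip L L) * Num.sqrt (ip (Y i - M) (Y i - M)).
apply: (@squeeze_cvgr _ _ _ _ (fun i => - b i) b).
- near=> i.
  have XiL : X i \in L2 by near: i.
  have YiL : Y i \in L2 by near: i.
  rewrite -ler_norml.
  have -> : ip (X i) (Y i) - ip L M
     = (ip (X i - L) (Y i - M) + ip (X i - L) M) + ip L (Y i - M).
    by rewrite !(ipBl, ipBr) ?L2B//; ring.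
  apply: le_trans (ler_normD _ _) _; apply: lerD; last by rewrite ip_norm_le ?L2B.
  apply: le_trans (ler_normD _ _) _.
  by rewrite mulrDr; apply: lerD; rewrite ip_norm_le ?L2B.
- rewrite -oppr0; apply: cvgN.
  rewrite (_ : 0 = 0 * (0 + Num.sqrt (ip M M)) + Num.sqrt (ip L L) * 0); last by ring.
  apply: cvgD; apply: cvgM => //; try exact: cvg_cst.
  by apply: cvgD => //; exact: cvg_cst.
- rewrite (_ : 0 = 0 * (0 + Num.sqrt (ip M M)) + Num.sqrt (ip L L) * 0); last by ring.
  apply: cvgD; apply: cvgM => //; try exact: cvg_cst.
  by apply: cvgD => //; exact: cvg_cst.
Unshelve. all: by end_near. Qed.

Lemma ms_cvg_comp (I J : Type) (F : set_system I) (G : set_system J)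
    {FF : Filter F} {FG : Filter G} (phi : J -> I) (X : I -> T -> R) (L : T -> R) :
  phi @ G --> F -> ms_cvg P F X L -> ms_cvg P G (X \o phi) L.
Proof.
move=> cphi [XL LL cv]; split=> //; first exact: (cphi _ XL).
exact: (cvg_comp _ _ cphi cv).
Qed.

Lemma ms_cvg_near (I : Type) (F : set_system I) {FF : Filter F}
    (X Y : I -> T -> R) (L : T -> R) :
  (\forall i \near F, X i = Y i) -> ms_cvg P F X L -> ms_cvg P F Y L.
Proof.
move=> XY [XL LL cv]; split=> //.
  by near=> i; rewrite -(near XY i)//; near: i.
apply: cvg_trans cv; apply: near_eq_cvg.
by apply: filterS XY => i ->.
Unshelve. all: by end_near. Qed.

Lemma ms_cvg_cst (I : Type) (F : set_system I) {FF : Filter F} (L : T -> R) :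
  L \in L2 -> ms_cvg P F (fun=> L) L.
Proof.
move=> LL; apply/ms_cvgP; split=> //; first exact: nearW.
by rewrite subrr ip0l; exact: cvg_cst.
Qed.

Lemma ms_cvgD (I : Type) (F : set_system I) {FF : Filter F}
    (X Y : I -> T -> R) (L M : T -> R) :
  ms_cvg P F X L -> ms_cvg P F Y M ->
  ms_cvg P F (fun i => X i + Y i) (L + M).
Proof.
move=> /ms_cvgP[XL LL cvX] /ms_cvgP[YL ML cvY]; apply/ms_cvgP; split.
- by near=> i; apply: L2D; near: i.
- exact: L2D.
apply: (@squeeze_cvgr _ _ _ _ (fun=> 0)
  (fun i => 2 * ip (X i - L) (X i - L) + 2 * ip (Y i - M) (Y i - M))).
- near=> i; rewrite ip_ge0/=.
  have XiL : X i \in L2 by near: i.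
  have YiL : Y i \in L2 by near: i.
  by rewrite opprD addrACA ip_add_le ?L2B.
- exact: cvg_cst.
- rewrite [X in _ --> X](_ : 0 = 2 * 0 + 2 * 0); last by ring.
  exact: (cvgD (cvgM (cvg_cst _) cvX) (cvgM (cvg_cst _) cvY)).
Unshelve. all: by end_near. Qed.

Lemma ms_cvgZ (I : Type) (F : set_system I) {FF : Filter F}
    (c : I -> R) (X : I -> T -> R) (a : R) (L : T -> R) :
  c i @[i --> F] --> a -> ms_cvg P F X L ->
  ms_cvg P F (fun i => c i *: X i) (a *: L).
Proof.
move=> ca XL0; have [XL LL _] := XL0.
have XX : ip (X i) (X i) @[i --> F] --> ip L L by exact: ms_cvg_ip.
have XLM : ip (X i) L @[i --> F] --> ip L L.
  by apply: ms_cvg_ip => //; exact: ms_cvg_cst.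
apply/ms_cvgP; split.
- by near=> i; apply: L2Z; near: i.
- exact: L2Z.
have H : c i * c i * ip (X i) (X i)
   - 2 * a * c i * ip (X i) L + a * a * ip L L @[i --> F] --> 0.
  rewrite [X in _ --> X](_ : 0 = a * a * ip L L - 2 * a * a * ip L L
    + a * a * ip L L); last by ring.
  exact: (cvgD (cvgB (cvgM (cvgM ca ca) XX)
    (cvgM (cvgM (cvg_cst _) ca) XLM)) (cvg_cst _)).
apply: cvg_trans H; apply: near_eq_cvg; near=> i.
have XiL : X i \in L2 by near: i.
by rewrite !(ipBl, ipBr) ?L2B ?L2Z// !(ipZl, ipZr) ?L2Z// (ipC P L); ring.
Unshelve. all: by end_near. Qed.

End MeanSquareLimits.

(** * Completeness *)

Section Completeness.
Context (R : realType) (disp : measure_display) (T : measurableType disp)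
  (P : probability T R).

Local Notation L2 := (Lfun P 2%:E).
Local Notation ip := (ip P).

(** Cauchy-Schwarz against the constant 1, whose norm is 1 because P is a probability. *)
Lemma E_norm_le (f : T -> R) (a : R) : f \in L2 -> 0 <= a ->
  ip f f <= a ^+ 2 -> (\int[P]_w `|f w|%:E <= a%:E)%E.
Proof.
move=> fL a0 fa; have mf := L2_measurable fL.
pose nf w := `|f w|.
have nf2 : nf * nf = f * f.
  by apply/funext => w; rewrite !fctE -normrM ger0_norm// -expr2 sqr_ge0.
have nfL : nf \in L2.
  apply: L2_sqr_lty; first exact: measurableT_comp.
  by rewrite nf2 ipE// ltry.
have c1 : (1 : T -> R) \in L2 by exact: (Lfun_cst P 1).
have ip11 : ip 1 1 = 1.
  by rewrite /ip mulr1 (_ : 1 = cst 1)// expectation_cst.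
have -> : (\int[P]_w `|f w|%:E = 'E_P[nf * 1])%E.
  by rewrite unlock; apply: eq_integral => w _; rewrite mulr1.
rewrite ipE// lee_fin.
have : ip nf 1 ^+ 2 <= a ^+ 2.
  apply: le_trans (ip_cauchy_schwarz nfL c1) _.
  by rewrite ip11 mulr1 /ip nf2.
move=> /ler_wsqrtr; rewrite !sqrtr_sqr (ger0_norm a0).
exact: le_trans (ler_norm _).
Qed.

(** The Riesz-Fischer argument: the increments have summable expectations, so the telescoping series
    converges absolutely almost everywhere, and Fatou's lemma turns the bounds on [f n - f k] into
    bounds on [f k - L]. *)
Lemma L2_fast_cauchy (f : nat -> T -> R) :
  (forall k, f k \in L2) ->
  (forall j k, (k <= j)%N -> ip (f j - f k) (f j - f k) <= (2 ^- k) ^+ 2) ->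
  exists2 L, L \in L2 & forall k, ip (f k - L) (f k - L) <= (2 ^- k) ^+ 2.
Proof.
move=> fL fC.
have mf k : measurable_fun setT (f k) by exact: L2_measurable.
pose d k w := `|f k.+1 w - f k w|.
have md k : measurable_fun setT (fun w => (d k w)%:E).
  apply/measurable_EFinP; apply: measurableT_comp => //.
  exact: measurable_funB.
have d0 k w : (0 <= (d k w)%:E)%E by rewrite lee_fin; exact: normr_ge0.
pose S w := (\sum_(k <oo) (d k w)%:E)%E.
have intS : (\int[P]_w S w < +oo)%E.
  rewrite integral_nneseries//.
  apply: (@le_lt_trans _ _ (\sum_(k <oo) (2 / (2 ^ (k + 1))%:R)%:E)%E).
    apply: lee_nneseries => [k _ _|k _]; first exact: integral_ge0.
    have -> : 2 / (2 ^ (k + 1))%:R = 2 ^- k :> R.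
      by rewrite addn1 expnS natrM natrX invfM mulVKf// pnatr_eq0.
    apply: (@E_norm_le (f k.+1 - f k)); [exact: L2B| |exact: fC].
    by rewrite invr_ge0 exprn_ge0.
  have := @cvg_geometric_eseries_half R 2 0.
  by move/cvg_lim => ->//; rewrite ltry.
have Sae : {ae P, forall w, (f k w)%:E @[k --> \oo]
    --> limn_esup (fun k => (f k w)%:E) /\
    limn_esup (fun k => (f k w)%:E) \is a fin_num}.
  have iS : P.-integrable setT S.
    apply/integrableP; split.
      by apply: ge0_emeasurable_sum => //.
    under eq_integral => w _ do rewrite gee0_abs ?nneseries_ge0//.
    exact: intS.
  have := integrable_ae measurableT iS; apply: filterS => w /(_ I) Sw.
  have cv : cvgn (f^~ w).
    have : cvgn (series (telescope (f^~ w))).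
      apply: normed_cvg; apply: nondecreasing_is_cvgn.
        apply: nondecreasing_series => n _ _; exact: normr_ge0.
      exists (fine (S w)) => _ [n _ <-]; rewrite -lee_fin fineK//.
      have := @nneseries_lim_ge R (fun k => (d k w)%:E) xpredT 0 n
        (fun k _ _ => d0 k w).
      by rewrite sumEFin; exact.
    rewrite telescopeK => cs.
    have -> : f^~ w = (fun n => (f n w - f 0%N w) + f 0%N w).
      by apply/funext => n; rewrite subrK.
    apply: is_cvgD; last exact: is_cvg_cst.
    exact: cs.
  have {}cv : (f k w)%:E @[k --> \oo] --> (limn (f^~ w))%:E.
    by apply: cvg_EFin; first exact: nearW.
  by rewrite (cvg_limn_einf_sup cv).2.
(* The upper limit is measurable without any convergence; on the null set where it is infinite,
   [fine] replaces it by 0. *)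
pose L w := fine (limn_esup (fun k => (f k w)%:E)).
have mL : measurable_fun setT L.
  apply: measurableT_comp => //.
  by apply: measurable_fun_limn_esup => k; exact/measurable_EFinP.
have fat k : ('E_P[(f k - L) * (f k - L)] <= ((2 ^- k) ^+ 2)%:E)%E.
  pose g j w := ((f k w - f j w) * (f k w - f j w))%:E.
  have mg j : measurable_fun setT (g j).
    by apply/measurable_EFinP; apply: measurable_funM; exact: measurable_funB.
  have g0 j w : setT w -> (0 <= g j w)%E by rewrite lee_fin -expr2 sqr_ge0.
  apply: (@le_trans _ _ (\int[P]_w limn_einf (g^~ w))%E).
    rewrite unlock; apply: ae_ge0_le_integral => //.
    - by move=> w _; rewrite lee_fin -expr2 sqr_ge0.
    - by apply/measurable_EFinP; apply: measurable_funM; exact: measurable_funB.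
    - move=> w _; rewrite limn_einf_lim; apply: lime_ge.
        exact: is_cvg_einfs.
      apply: nearW => n; apply: le_ereal_inf_tmp => _ [m _ <-].
      exact: g0.
    - rewrite /limn_einf; apply: measurableT_comp => //.
      by apply: measurable_fun_limn_esup => j; apply: measurableT_comp.
    apply: filterS Sae => w [cv fn] _.
    have cvL : f j w @[j --> \oo] --> L w.
      by move: cv; rewrite -[X in _ --> X](fineK fn) => /fine_cvgP[].
    have cvg' : g j w @[j --> \oo] --> ((f k w - L w) * (f k w - L w))%:E.
      apply: cvg_EFin; first exact: nearW.
      by apply: cvgM; apply: cvgB => //; exact: cvg_cst.
    by rewrite (cvg_limn_einf_sup cvg').1.
  apply: le_trans (fatou _ measurableT mg g0) _.
  rewrite limn_einf_lim; apply: lime_le; first exact: is_cvg_einfs.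
  exists k => // n /= kn; apply: ge_ereal_inf.
  exists (\int[P]_w g n w)%E; first by exists n => //=.
  have -> : (\int[P]_w g n w = 'E_P[(f k - f n) * (f k - f n)])%E.
    by rewrite unlock.
  by rewrite ipE ?L2B// lee_fin ip_distC fC.
have fLL k : f k - L \in L2.
  apply: L2_sqr_lty; first exact: measurable_funB.
  by apply: le_lt_trans (fat k) _; rewrite ltry.
exists L.
  by rewrite -(subKr (f 0%N) L) L2B.
by move=> k; rewrite -lee_fin -ipE.
Qed.

End Completeness.

(** F may have no countable base, so one index is picked in each of countably many sets on which X
    varies by at most 2 ^ - k in norm. The limit of this sequence is then the limit along F. *)
Lemma ms_cauchy_cvg (R : realType) (disp : measure_display)
    (T : measurableType disp) (P : probability T R) (I : Type)
    (F : set_system I) {FF : ProperFilter F} (X : I -> T -> R) :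
  (\forall i \near F, X i \in Lfun P 2%:E) ->
  (forall e, 0 < e -> exists2 S : set I, F S &
    forall i j, S i -> S j -> ip P (X i - X j) (X i - X j) <= e) ->
  exists L, ms_cvg P F X L.
Proof.
move=> XL cau.
have ex k : exists S : set I, [/\ F S, (forall i, S i -> X i \in Lfun P 2%:E) &
    forall i j, S i -> S j -> ip P (X i - X j) (X i - X j) <= (2 ^- k) ^+ 2].
  have [|S FS HS] := cau ((2 ^- k) ^+ 2); first by rewrite exprn_gt0// invr_gt0 exprn_gt0.
  exists (S `&` [set i | X i \in Lfun P 2%:E]); split; first exact: filterI.
    by move=> i [].
  by move=> i j [? _] [? _]; exact: HS.
have [S HS] := choice ex.
(* [U k] is the intersection of [S 0], ..., [S k], so an index picked in [U j] lies in every [S k]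
   with k <= j. *)
pose U := fix U k := if k is k'.+1 then U k' `&` S k'.+1 else S 0%N.
have FU k : F (U k).
  by elim: k => [|k IH] /=; [have [] := HS 0%N|apply: filterI => //; have [] := HS k.+1].
have US k j : (k <= j)%N -> U j `<=` S k.
  elim: j => [|j IH]; first by rewrite leqn0 => /eqP ->.
  rewrite leq_eqVlt ltnS => /orP[/eqP ->|kj] i [] //.
  by move=> /(IH kj).
have [s Us] := choice (fun k => filter_ex (FU k)).
have sS k j : (k <= j)%N -> S k (s j) by move=> kj; apply: US (Us j).
have SL k i : S k i -> X i \in Lfun P 2%:E by have [_ + _] := HS k; exact.
have [L LL HL] : exists2 L, L \in Lfun P 2%:E & forall k,
    ip P (X (s k) - L) (X (s k) - L) <= (2 ^- k) ^+ 2.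
  apply: (@L2_fast_cauchy _ _ _ _ (X \o s)) => [k|j k kj].
    exact: SL (sS _ _ (leqnn k)).
  by have [_ _] := HS k; apply; exact: sS.
exists L; apply/ms_cvgP; split => //.
apply/cvgr0Pnorm_lt => e e0.
(* [ip_sub_le] doubles two terms, each at most 2 ^ - k < e / 4. *)
have e40 : 0 < e / 4 by rewrite divr_gt0.
have [k _ /(_ k (leqnn k)) /= Hk] := near_infty_natSinv_expn_lt (PosNum e40).
have [FS _ CS] := HS k; apply: filterS FS => i Si.
rewrite ger0_norm ?ip_ge0//.
have skS := sS _ _ (leqnn k).
have k1 : (2 ^- k : R) <= 1 by rewrite invf_le1 ?exprn_gt0// exprn_ege1// ler1n.
have kk : (2 ^- k : R) ^+ 2 <= 2 ^- k.
  by rewrite expr2 ler_piMl// invr_ge0 exprn_ge0.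
apply: le_lt_trans (ip_sub_le (SL _ _ Si) (SL _ _ skS) LL) _.
have := CS _ _ Si skS; have := HL k; move: Hk kk; rewrite div1r.
lra.
Qed.

(** The square of [X i - X j] expands into four inner products, each within e / 4 of l, in which the
    multiples of l cancel. *)
Lemma ms_cvg_of_ip (R : realType) (disp : measure_display)
    (T : measurableType disp) (P : probability T R) (I : Type)
    (F : set_system I) {FF : ProperFilter F} (X : I -> T -> R) (l : R) :
  (\forall i \near F, X i \in Lfun P 2%:E) ->
  (forall e, 0 < e -> exists2 S : set I, F S &
    forall i j, S i -> S j -> `|ip P (X i) (X j) - l| <= e) ->
  exists L, ms_cvg P F X L.
Proof.
move=> XL cau; apply: ms_cauchy_cvg => // e e0.
have [|S FS HS] := cau (e / 4); first by rewrite divr_gt0.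
exists (S `&` [set i | X i \in Lfun P 2%:E]); first exact: filterI.
move=> i j [Si XiL] [Sj XjL].
rewrite !(ipBl, ipBr) ?L2B// (ipC P (X j) (X i)).
move: (HS i j Si Sj) (HS i i Si Si) (HS j j Sj Sj).
rewrite !ler_norml; lra.
Qed.

(** * Differentiation relative to an interval *)

Section Within.
Context (R : realType) (A : set R).
Implicit Types (f g : R -> R) (s t l : R).

(* Caratheodory's form of differentiability relative to A; the limit includes
   the point t itself, so that the slope function takes the value l there. *)
Definition dwithin f l t :=
  exists2 q : R -> R, q s @[s --> within A (nbhs t)] --> l &
    forall s, A s -> f s - f t = q s * (s - t).

Lemma dwithin_cvg f l t : A t -> dwithin f l t ->
  f s @[s --> within A (nbhs t)] --> f t.
Proof.
move=> At [q ql fq].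
have H : f t + q s * (s - t) @[s --> within A (nbhs t)] --> f t.
  rewrite [X in _ --> X](_ : _ = f t + l * (t - t)); last by rewrite subrr mulr0 addr0.
  apply: cvgD; first exact: cvg_cst.
  apply: cvgM => //; apply: cvgB; last exact: cvg_cst.
  exact: cvg_within.
apply: cvg_trans H; apply: near_eq_cvg.
rewrite near_withinE; apply: nearW => s As.
by rewrite -fq// addrC subrK.
Qed.

Lemma dwithin_cst (c : R) t : dwithin (fun=> c) 0 t.
Proof. by exists (fun=> 0); [exact: cvg_cst|move=> s _; rewrite subrr mul0r]. Qed.

Lemma dwithinD f g l m t : dwithin f l t -> dwithin g m t ->
  dwithin (fun s => f s + g s) (l + m) t.
Proof.
move=> [q ql fq] [r rm gr]; exists (fun s => q s + r s); first exact: cvgD.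
by move=> s As; rewrite mulrDl -fq// -gr//; ring.
Qed.

Lemma dwithinM f g l m t : A t -> dwithin f l t -> dwithin g m t ->
  dwithin (fun s => f s * g s) (l * g t + f t * m) t.
Proof.
move=> At [q ql fq] dg; have gc := dwithin_cvg At dg.
have [r rm gr] := dg.
exists (fun s => q s * g s + f t * r s).
  by apply: cvgD; apply: cvgM => //; exact: cvg_cst.
move=> s As; rewrite mulrDl mulrAC -fq// -[f t * r s * _]mulrA -gr//; ring.
Qed.

Lemma dwithin_comp (phi : R -> R) f l m t : A t ->
  is_derive (f t) 1 phi m -> dwithin f l t ->
  dwithin (phi \o f) (m * l) t.
Proof.
move=> At /is_derive1_caratheodory[h [hE hc hm]] df.
have fc := dwithin_cvg At df; have [q ql fq] := df.
exists (fun s => h (f s) * q s).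
  apply: cvgM => //; rewrite -hm; exact: (cvg_comp _ _ fc hc).
by move=> s As /=; rewrite hE fq// mulrA.
Qed.

(** A point strictly between a and b has a neighbourhood inside A, so there the relative derivative
    is an ordinary one; at the endpoints only continuity relative to A is needed. *)
Lemma dwithin_MVT_lt f (f' : R -> R) a b : is_interval A -> A a -> A b ->
  a < b -> (forall t, A t -> dwithin f (f' t) t) ->
  exists2 c, c \in `]a, b[ & f b - f a = f' c * (b - a).
Proof.
move=> iA Aa Ab ab df; have Ain x : a <= x <= b -> A x by exact: iA.
apply: MVT => // [x xab|]; last first.
  apply/subspace_continuousP => x /=; rewrite in_itv/= => xab.
  have Ax := Ain _ xab; have H := dwithin_cvg Ax (df _ Ax).
  apply: cvg_trans H; apply: cvg_app => U.
  move=> UA; have AU : \forall y \near x, A y -> U y by exact: UA.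
  suff: \forall y \near x, `[a, b]%classic y -> U y by [].
  by apply: filterS AU => y Uy; rewrite /= in_itv/= => /Ain; exact: Uy.
have Ax : A x by apply: Ain; move: xab; rewrite in_itv/= => /andP[/ltW -> /ltW ->].
have nA : \forall y \near x, A y.
  have : \forall y \near x, y \in `]a, b[ by exact: near_in_itvoo.
  apply: filterS => y; rewrite in_itv/= => /andP[ay yb].
  by apply: Ain; rewrite (ltW ay) (ltW yb).
have [q ql fq] := df _ Ax.
apply/is_derive1_caratheodory.
(* The slope equation holds for q only on A, whereas the ordinary derivative asks for it at every
   z. *)
pose h z := if z == x then f' x else (f z - f x) / (z - x).
exists h; split; last by rewrite /h eqxx.
  move=> z; rewrite /h; case: eqP => [->|/eqP zx]; first by rewrite !subrr mulr0.
  by rewrite divfK// subr_eq0.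
have qx : q z @[z --> x] --> f' x.
  apply: cvg_trans ql; apply: cvg_app => U.
  move=> UA; have AU : \forall y \near x, A y -> U y by exact: UA.
  suff: \forall y \near x, U y by [].
  by apply: filterS2 AU nA => y; exact.
apply/cvgrPdist_lt => e e0; rewrite [h x]/h eqxx.
move/cvgrPdist_lt : qx => /(_ e e0) qx.
near=> z; rewrite /h; case: eqP => [_|/eqP zx]; first by rewrite subrr normr0.
rewrite fq; last by near: z.
by rewrite mulfK ?subr_eq0//; near: z.
Unshelve. all: by end_near. Qed.

Lemma dwithin_MVT f (f' : R -> R) a b : is_interval A -> A a -> A b ->
  a != b -> (forall t, A t -> dwithin f (f' t) t) ->
  exists c, [/\ A c, `|c - a| <= `|b - a| & f b - f a = f' c * (b - a)].
Proof.
move=> iA Aa Ab; rewrite neq_lt => /orP[ab|ba] df.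
  have [c] := dwithin_MVT_lt iA Aa Ab ab df.
  rewrite in_itv/= => /andP[ac cb] E; exists c; split => //.
    by apply: (iA a b) => //; rewrite (ltW ac) (ltW cb).
  by rewrite !ger0_norm ?subr_ge0 ?(ltW ab) ?(ltW ac)// lerB// ltW.
have [c] := dwithin_MVT_lt iA Ab Aa ba df.
rewrite in_itv/= => /andP[bc ca] E; exists c; split => //.
- by apply: (iA b a) => //; rewrite (ltW bc) (ltW ca).
- by rewrite !ler0_norm ?subr_le0 ?(ltW ba) ?(ltW ca)// lerN2 lerB// ltW.
- by rewrite -opprB E; ring.
Qed.

(** The filter of the joint limit: the shift e tends to 0 from the right while the two parameters
    tend to s and t inside A, the values s and t included. *)
Definition jnbhs s t : set_system (R * R * R) :=
  filter_prod (filter_prod 0^'+ (within A (nbhs s))) (within A (nbhs t)).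

Global Instance jnbhs_filter s t : Filter (jnbhs s t).
Proof. rewrite /jnbhs; typeclasses eauto. Qed.

Definition jcvg (F : R -> R -> R -> R) l s t :=
  F p.1.1 p.1.2 p.2 @[p --> jnbhs s t] --> l.

Lemma jcvg_bound (F : R -> R -> R -> R) l s t : jcvg F l s t ->
  forall e : R, 0 < e -> exists2 r : R, 0 < r & forall u s' t', 0 < u -> u < r ->
    A s' -> A t' -> `|s' - s| < r -> `|t' - t| < r -> `|F u s' t' - l| < e.
Proof.
move=> /cvgrPdist_lt Fl e /Fl.
move=> [[P Q] /= [[[P1 P2] /= [P1n P2n] P12] Qn] PQ].
have [r1 r10 H1] := P1n; have [r2 r20 H2] := P2n; have [r3 r30 H3] := Qn.
exists (Num.min r1 (Num.min r2 r3)); first by rewrite !lt_min r10 r20 r30.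
move=> u s' t' u0; rewrite !lt_min => /and3P[u1 _ _] As At.
move=> /and3P[_ s2 _] /and3P[_ _ t3]; rewrite distrC.
apply: (PQ (u, s', t')); split => /=.
  apply: P12; split => /=.
    by apply: H1 => //=; rewrite sub0r normrN gtr0_norm.
  by apply: H2 => //=; rewrite distrC.
by apply: H3 => //=; rewrite distrC.
Qed.

End Within.

(** * Mean-square differentiability from the covariance kernel *)

Section Loeve.
Context (R : realType) (disp : measure_display) (T : measurableType disp)
  (P : probability T R) (A : set R).
Hypotheses (iA : is_interval A) (A2 : exists a b, [/\ A a, A b & a != b]).

Local Notation L2 := (Lfun P 2%:E).
Local Notation ip := (ip P).

Lemma within_punctured_proper t : A t -> ProperFilter (within A t^').
Proof.
move=> At; apply: Build_ProperFilter_ex => B [r /= r0 rB].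
have [c Ac ct] : exists2 c, A c & c != t.
  have [a [b [Aa Ab ab]]] := A2.
  have [<-|at_] := eqVneq a t; last by exists a.
  by exists b => //; rewrite eq_sym.
have ct0 : 0 < `|c - t| by rewrite normr_gt0 subr_eq0.
(* The bound 1 keeps the point between t and c, hence in A; the other bound brings it within r / 2
   of t. *)
pose m := Num.min 1 (r / 2 / `|c - t|).
have m0 : 0 < m by rewrite lt_min ltr01 !divr_gt0.
have m1 : m <= 1 by rewrite ge_min lexx.
have mr : m * `|c - t| < r.
  have : m <= r / 2 / `|c - t| by rewrite ge_min lexx orbT.
  by rewrite ler_pdivlMr// => /le_lt_trans; apply; lra.
exists (t + m * (c - t)); apply: rB => /=.
- by rewrite opprD addrA subrr sub0r normrN normrM gtr0_norm.
- by rewrite -subr_eq0 addrAC subrr add0r mulf_neq0 ?subr_eq0// gt_eqF.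
- have [ct'|ct'] := leP t c; [apply: (iA At Ac)|apply: (iA Ac At)]; nra.
Qed.

Definition slope (f : R -> T -> R) s s' : T -> R :=
  (s' - s)^-1 *: (f s' - f s).

Lemma slopeE f s s' : slope f s s' = (fun w => (f s' w - f s w) / (s' - s)).
Proof. by apply/funext => w; rewrite [RHS]mulrC. Qed.

(** The mean value theorem is applied in s to the difference of the sections at t' and t, then in t
    to [F1 x]. *)
Lemma kernel_increment (F0 F1 F2 : R -> R -> R) s s' t t' :
  (forall s t, A s -> A t -> dwithin A (F0 ^~ t) (F1 s t) s) ->
  (forall s t, A s -> A t -> dwithin A (F1 s) (F2 s t) t) ->
  A s -> A s' -> A t -> A t' -> s != s' -> t != t' ->
  exists x y, [/\ A x, A y, `|x - s| <= `|s' - s|, `|y - t| <= `|t' - t| &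
    F0 s' t' - F0 s' t - F0 s t' + F0 s t = F2 x y * (s' - s) * (t' - t)].
Proof.
move=> d1 d2 As As' At At' ss' tt'.
have [|x [Ax xs E1]] := @dwithin_MVT R A (fun s => F0 s t' + - 1 * F0 s t)
    (fun s => F1 s t' + (0 * F0 s t + - 1 * F1 s t)) s s' iA As As' ss'.
  move=> u Au; apply: dwithinD; first exact: d1.
  by apply: dwithinM => //; [exact: dwithin_cst|exact: d1].
have [y [Ay yt E2]] := dwithin_MVT iA At At' tt' (d2 x ^~ Ax).
exists x, y; split => //.
rewrite mulrAC -E2; move: E1; lra.
Qed.

Section step.
Variables (f : R -> T -> R) (F0 F1 F2 : R -> R -> R -> R) (l0 l2 : R -> R -> R).
Hypotheses
  (d1 : forall e, 0 < e -> forall s t, A s -> A t ->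
     dwithin A (F0 e ^~ t) (F1 e s t) s)
  (d2 : forall e, 0 < e -> forall s t, A s -> A t ->
     dwithin A (F1 e s) (F2 e s t) t)
  (F0l : forall s t, A s -> A t -> jcvg A F0 (l0 s t) s t)
  (F2l : forall s t, A s -> A t -> jcvg A F2 (l2 s t) s t)
  (fL : forall t, A t -> f t \in L2)
  (fl : forall s t, A s -> A t -> ip (f s) (f t) = l0 s t).

Lemma jcvg_at s t : A s -> A t -> F0 e s t @[e --> 0^'+] --> l0 s t.
Proof.
move=> As At; apply/cvgrPdist_lt => e e0.
have [r r0 H] := jcvg_bound (F0l As At) e0.
near=> u; rewrite distrC H ?subrr ?normr0//.
Unshelve. all: by end_near. Qed.

(** The inner product of two slopes is a second difference quotient of l0, the limit as u -> 0+ of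
    those of [F0 u]. Each of the latter is a value of [F2 u] at a point near (s, t) depending on u,
    which the joint limit of F2 controls; the bound then passes to the limit in u. *)
Lemma slope_ip_bound s t : A s -> A t -> forall e : R, 0 < e ->
  exists2 r : R, 0 < r & forall s' t', A s' -> A t' -> s' != s -> t' != t ->
    `|s' - s| < r -> `|t' - t| < r ->
    `|ip (slope f s s') (slope f t t') - l2 s t| <= e.
Proof.
move=> As At e e0; have [r r0 H] := jcvg_bound (F2l As At) e0.
exists r => // s' t' As' At' ss' tt' sr tr.
have -> : ip (slope f s s') (slope f t t')
    = (l0 s' t' - l0 s' t - l0 s t' + l0 s t) / (s' - s) / (t' - t).
  rewrite /slope !(ipZl, ipZr) ?L2Z ?L2B ?fL// !(ipBl, ipBr) ?L2B ?fL//.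
  by rewrite !fl//; ring.
have cv : (F0 u s' t' - F0 u s' t - F0 u s t' + F0 u s t) / (s' - s) / (t' - t)
    - l2 s t @[u --> 0^'+] -->
    (l0 s' t' - l0 s' t - l0 s t' + l0 s t) / (s' - s) / (t' - t) - l2 s t.
  apply: cvgB; last exact: cvg_cst.
  apply: cvgM; last exact: cvg_cst.
  apply: cvgM; last exact: cvg_cst.
  apply: cvgD; last exact: jcvg_at.
  apply: cvgB; last exact: jcvg_at.
  by apply: cvgB; exact: jcvg_at.
apply: (cvgr_to_le (cvg_norm cv)); near=> u.
have u0 : 0 < u by [].
have [x [y [Ax Ay xs yt ->]]] : exists x y, [/\ A x, A y,
    `|x - s| <= `|s' - s|, `|y - t| <= `|t' - t| &
    F0 u s' t' - F0 u s' t - F0 u s t' + F0 u s t = F2 u x y * (s' - s) * (t' - t)].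
  apply: (@kernel_increment _ (F1 u)) => //; [exact: d1|exact: d2| |]; by rewrite eq_sym.
rewrite mulrAC mulfK ?subr_eq0// mulfK ?subr_eq0// ltW// H//.
- exact: le_lt_trans sr.
- exact: le_lt_trans tr.
Unshelve. all: by end_near. Qed.

(* Cauchy's criterion for the slopes of f, whose inner products tend to l2. *)
Lemma loeve_step : exists g, [/\ ms_deriv_on P A f g,
  (forall t, A t -> g t \in L2) &
  forall s t, A s -> A t -> ip (g s) (g t) = l2 s t].
Proof.
have slL t : A t -> \forall s \near within A t^', slope f t s \in L2.
  move=> At; rewrite near_withinE; apply: nearW => s As.
  by rewrite L2Z// L2B// fL.
have ex t : exists L, A t -> ms_cvg P (within A t^') (slope f t) L.
  have [At|nAt] := pselect (A t); last by exists 0.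
  have := within_punctured_proper At => PF.
  have [|L HL] := @ms_cvg_of_ip _ _ _ P _ _ PF (slope f t) (l2 t t) (slL _ At).
    move=> e e0; have [r r0 H] := slope_ip_bound At At e0.
    exists [set s | [/\ A s, s != t & `|s - t| < r]].
      exists r => // s /= str st As; split => //.
      by rewrite distrC.
    by move=> i j [Ai it ir] [Aj jt jr]; exact: H.
  by exists L.
have [g Hg] := choice ex; exists g; split.
- move=> t At; have := Hg t At; apply: ms_cvg_near.
  by apply: nearW => s; rewrite slopeE.
- by move=> t At; have [] := Hg t At.
move=> s t As At.
have PFs := within_punctured_proper As; have PFt := within_punctured_proper At.
(* Independent increments at s and t: the inner products of the two slopes tend to that of the
   derivatives, and [slope_ip_bound] shows that they also tend to l2. *)
pose FF := filter_prod (within A s^') (within A t^').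
have c1 : ms_cvg P FF (slope f s \o fst) (g s).
  by apply: ms_cvg_comp (Hg s As); exact: cvg_fst.
have c2 : ms_cvg P FF (slope f t \o snd) (g t).
  by apply: ms_cvg_comp (Hg t At); exact: cvg_snd.
have cip : ip (slope f s p.1) (slope f t p.2) @[p --> FF] --> ip (g s) (g t).
  exact: ms_cvg_ip c1 c2.
apply: (cvg_unique _ cip) => //=.
apply/cvgrPdist_le => e e0.
have [r r0 H] := slope_ip_bound As At e0.
exists ([set u | [/\ A u, u != s & `|u - s| < r]],
  [set u | [/\ A u, u != t & `|u - t| < r]]) => /=.
  split; exists r => // u /= ur us Au; split => //; by rewrite distrC.
by move=> [u v] /= [[Au us ur] [Av vt vr]]; rewrite distrC; exact: H.
Qed.

(** The square of [f s - f t] is a combination of four values of l0 in which [l0 t t] cancels, and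
    l0 inherits continuity at (t, t) from the joint limit of F0. *)
Lemma ms_continuous_of_kernel : ms_continuous_on P A f.
Proof.
move=> t At; apply/ms_cvgP; split; [|exact: fL|].
  by rewrite near_withinE; apply: nearW => s; exact: fL.
apply/cvgr0Pnorm_le => e e0.
have e4 : 0 < e / 4 by rewrite divr_gt0.
have [r r0 H] := jcvg_bound (F0l At At) e4.
have K s' t' : A s' -> A t' -> `|s' - t| < r -> `|t' - t| < r ->
    `|l0 s' t' - l0 t t| <= e / 4.
  move=> As' At' sr tr.
  have cv : F0 u s' t' - l0 t t @[u --> 0^'+] --> l0 s' t' - l0 t t.
    by apply: cvgB; [exact: jcvg_at|exact: cvg_cst].
  apply: (cvgr_to_le (cvg_norm cv)); near=> u.
  by rewrite ltW// H.
exists r => // s /=; rewrite distrC => sr As.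
rewrite ger0_norm ?ip_ge0// !(ipBl, ipBr) ?L2B ?fL// !fl//.
have := K s s As As sr sr.
have tr : `|t - t| < r by rewrite subrr normr0.
have := K s t As At sr tr; have := K t s At As tr sr.
rewrite !ler_norml; lra.
Unshelve. all: by end_near. Qed.

End step.

(** [kern k] stands for a class of regularized kernels already differentiated k times in each
    parameter. The derivative of f has its kernel one class higher, so the induction on n lets k
    grow, keeping k + n at most N. *)
Lemma ms_Cn_of_kernel (N : nat) (kern : nat -> (R -> R -> R -> R) -> Prop) :
  (forall k F, (k <= N)%N -> kern k F ->
     forall s t, A s -> A t -> exists l, jcvg A F l s t) ->
  (forall k F, (k < N)%N -> kern k F -> exists F1 F2, [/\ kern k.+1 F2,
     forall e, 0 < e -> forall s t, A s -> A t ->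
       dwithin A (F e ^~ t) (F1 e s t) s &
     forall e, 0 < e -> forall s t, A s -> A t ->
       dwithin A (F1 e s) (F2 e s t) t]) ->
  forall n k F l f, (k + n <= N)%N -> kern k F ->
    (forall s t, A s -> A t -> jcvg A F (l s t) s t) ->
    (forall t, A t -> f t \in L2) ->
    (forall s t, A s -> A t -> ip (f s) (f t) = l s t) ->
  ms_Cn_on P n A f.
Proof.
move=> Clim Cder; elim=> [|n IH] k F l f kN ClF Fl fL fl /=.
  exact: ms_continuous_of_kernel Fl fL fl.
have kN' : (k < N)%N by apply: leq_trans kN; rewrite addnS ltnS leq_addr.
have [F1 [F2 [ClF2 d1 d2]]] := Cder _ _ kN' ClF.
have ex (p : R * R) : exists l2, A p.1 -> A p.2 -> jcvg A F2 l2 p.1 p.2.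
  have [[As At]|nA] := pselect (A p.1 /\ A p.2).
    by have [l2 H] := Clim _ _ kN' ClF2 _ _ As At; exists l2.
  by exists 0 => As At; case: nA.
have [l2 Hl2] := choice ex.
have F2l s t : A s -> A t -> jcvg A F2 (l2 (s, t)) s t.
  by move=> As At; exact: (Hl2 (s, t)).
have [g [fg gL gl]] := loeve_step d1 d2 Fl F2l fL fl.
exists g => //; apply: (IH k.+1 F2 (fun s t => l2 (s, t))) => //.
by rewrite addSnnS.
Qed.

End Loeve.

(** * Mean-square derivatives of Z and derivatives of gamma *)

Section MeanSquareKernel.
Context (R : realType) (disp : measure_display) (T : measurableType disp)
  (P : probability T R) (A : set R).

Local Notation L2 := (Lfun P 2%:E).
Local Notation ip := (ip P).

Definition ms_dwithin (f : R -> T -> R) (g : T -> R) (t : R) :=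
  exists2 q : R -> T -> R, ms_cvg P (within A (nbhs t)) q g &
    forall s, A s -> f s - f t = (s - t) *: q s.

Lemma ms_dwithin_deriv f g t : (forall s, A s -> f s \in L2) -> A t ->
  ms_cvg P (within A t^') (fun s w => (f s w - f t w) / (s - t)) g ->
  ms_dwithin f g t.
Proof.
move=> fL At /ms_cvgP[qL gL qg].
(* The limit along [within A (nbhs t)] sees the point t itself, so the slope must take the value g
   there. *)
pose q s := if s == t then g else (s - t)^-1 *: (f s - f t).
have qE s : s != t -> q s = (fun w => (f s w - f t w) / (s - t)).
  by move=> /negPf st; rewrite /q st; apply/funext => w; rewrite [RHS]mulrC.
exists q; last first.
  move=> s As; rewrite /q; case: eqP => [->|/eqP st].
    by rewrite !subrr scale0r.
  by rewrite scalerA divff ?scale1r// subr_eq0.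
apply/ms_cvgP; split => //.
  rewrite near_withinE; apply: nearW => s As; rewrite /q; case: ifP => // _.
  by rewrite L2Z// L2B// fL.
apply/cvgr0Pnorm_lt => e e0.
move/cvgr0Pnorm_lt : qg => /(_ e e0) [r /= r0 H].
exists r => // s /= sr As; have [->|st] := eqVneq s t.
  by rewrite /q eqxx subrr ip0l normr0.
by rewrite qE//; exact: H.
Qed.

Lemma ms_dwithin_cvg f g t : f t \in L2 -> ms_dwithin f g t ->
  ms_cvg P (within A (nbhs t)) f (f t).
Proof.
move=> fL [q qg fq].
have H : ms_cvg P (within A (nbhs t)) (fun s => f t + (s - t) *: q s)
    (f t + (t - t) *: g).
  apply: ms_cvgD; first exact: ms_cvg_cst.
  apply: ms_cvgZ => //; apply: cvgB; last exact: cvg_cst.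
  exact: cvg_within.
move: H; rewrite subrr scale0r addr0; apply: ms_cvg_near.
rewrite near_withinE; apply: nearW => s As.
by rewrite -fq// addrC subrK.
Qed.

Lemma dwithin_ip f g f' g' t : A t -> f t \in L2 ->
  (forall s, A s -> f s \in L2) -> (forall s, A s -> g s \in L2) ->
  ms_dwithin f f' t -> ms_dwithin g g' t ->
  dwithin A (fun s => ip (f s) (g s)) (ip f' (g t) + ip (f t) g') t.
Proof.
move=> At ftL fL gL df dg.
have gc := ms_dwithin_cvg (gL _ At) dg.
have [q qf fq] := df; have [r rg gr] := dg.
have H : ip (q s) (g s) + ip (f t) (r s) @[s --> within A (nbhs t)]
    --> ip f' (g t) + ip (f t) g'.
  apply: cvgD; apply: ms_cvg_ip => //; exact: ms_cvg_cst.
(* q t and r t need not be square-integrable, so the slope is redefined at t. *)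
exists (fun s => if s == t then ip f' (g t) + ip (f t) g'
  else (ip (f s) (g s) - ip (f t) (g t)) / (s - t)).
  apply/cvgrPdist_lt => e e0; move/cvgrPdist_lt : H => /(_ e e0) H.
  near=> s; case: eqP => [_|/eqP st]; first by rewrite subrr normr0.
  have As : A s.
    near: s; rewrite near_withinE; exact: nearW.
  rewrite [X in _ - X](_ : _ = ip (q s) (g s) + ip (f t) (r s)); last first.
    have qE : q s = (s - t)^-1 *: (f s - f t).
      by rewrite fq// scalerA mulVf ?scale1r// subr_eq0.
    have rE : r s = (s - t)^-1 *: (g s - g t).
      by rewrite gr// scalerA mulVf ?scale1r// subr_eq0.
    rewrite qE rE !(ipZl, ipZr) ?L2Z ?L2B ?fL ?gL// !(ipBl, ipBr) ?fL ?gL//.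
    by ring.
  by near: s.
move=> s As; case: eqP => [->|/eqP st]; first by rewrite !subrr mulr0.
by rewrite divfK// subr_eq0.
Unshelve. all: by end_near. Qed.

(** The nested existentials of [ms_Cn_on] become a single sequence of derivatives; its entries of
    index above n are left arbitrary. *)
Lemma ms_Cn_derivs n f : (forall t, A t -> f t \in L2) -> ms_Cn_on P n A f ->
  exists Z : nat -> R -> T -> R, [/\ Z 0%N = f,
    forall i t, (i <= n)%N -> A t -> Z i t \in L2,
    forall i t, (i < n)%N -> A t -> ms_dwithin (Z i) (Z i.+1 t) t &
    forall i t, (i <= n)%N -> A t ->
      ms_cvg P (within A (nbhs t)) (Z i) (Z i t)].
Proof.
elim: n f => [|n IH] f fL.
  move=> cf; exists (fun=> f); split => // [i t i0 At|i t i0 At].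
    exact: fL.
  exact: cf.
move=> [g fg cg].
have gL t : A t -> g t \in L2 by move=> At; have [] := fg t At.
have [Z [Z0 ZL Zd Zc]] := IH g gL cg.
have d0 t : A t -> ms_dwithin f (g t) t.
  by move=> At; apply: ms_dwithin_deriv => //; exact: fg.
exists (fun i => if i is j.+1 then Z j else f); split => //.
- by case=> [|i] t; [move=> _; exact: fL|exact: ZL].
- by case=> [|i] t; [move=> _; rewrite Z0; exact: d0|exact: Zd].
- case=> [|i] t; last exact: Zc.
  by move=> _ At; apply: ms_dwithin_cvg (d0 _ At); exact: fL.
Qed.

Variables (N : nat) (Z : nat -> R -> T -> R).
Hypotheses
  (ZL : forall i t, (i <= N)%N -> A t -> Z i t \in L2)
  (Zd : forall i t, (i < N)%N -> A t -> ms_dwithin (Z i) (Z i.+1 t) t)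
  (Zc : forall i t, (i <= N)%N -> A t ->
     ms_cvg P (within A (nbhs t)) (Z i) (Z i t)).

(* The partial derivative of order (i, j) of (s, t) |-> Z_s - Z_t. *)
Definition incr i j (s t : R) : T -> R :=
  (if j is 0 then Z i s else 0) - (if i is 0 then Z j t else 0).

(** Gamma is [atom 0 0 0 0], and by the product rule all its derivatives are sums of atoms. *)
Definition atom i j i' j' s t := ip (incr i j s t) (incr i' j' s t).

Lemma incr_L2 i j s t : (i <= N)%N -> (j <= N)%N -> A s -> A t ->
  incr i j s t \in L2.
Proof.
by move=> iN jN As At; apply: L2B; [case: j jN|case: i iN] => *;
  rewrite ?L2_0 ?ZL.
Qed.

Lemma incr_cvg i j s t : (i <= N)%N -> (j <= N)%N -> A s -> A t ->
  ms_cvg P (jnbhs A s t) (fun p => incr i j p.1.2 p.2) (incr i j s t).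
Proof.
move=> iN jN As At; rewrite /incr.
have cs k : (k <= N)%N -> ms_cvg P (jnbhs A s t) (fun p => Z k p.1.2) (Z k s).
  move=> kN; apply: (@ms_cvg_comp _ _ _ _ _ _ _ _ _ _ (fun p => p.1.2) _ _ _ (Zc kN As)).
  exact: (cvg_comp _ _ cvg_fst cvg_snd).
have ct k : (k <= N)%N -> ms_cvg P (jnbhs A s t) (fun p => Z k p.2) (Z k t).
  move=> kN; apply: (@ms_cvg_comp _ _ _ _ _ _ _ _ _ _ (fun p => p.2) _ _ _ (Zc kN At)).
  exact: cvg_snd.
have N1 X L : ms_cvg P (jnbhs A s t) X L -> ms_cvg P (jnbhs A s t) (fun p => - X p) (- L).
  move=> XL; rewrite -scaleN1r; under eq_fun do rewrite -scaleN1r.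
  by apply: ms_cvgZ => //; exact: cvg_cst.
apply: ms_cvgD.
  by case: j {jN} => [|j]; [exact: cs|apply: ms_cvg_cst; exact: L2_0].
apply: N1.
by case: i {iN} => [|i]; [exact: ct|apply: ms_cvg_cst; exact: L2_0].
Qed.

Lemma incr_ds i j s t : (i < N)%N -> (j <= N)%N -> A s -> A t ->
  ms_dwithin (fun s => incr i j s t) (incr i.+1 j s t) s.
Proof.
move=> iN jN As At; rewrite /incr subr0; case: j {jN} => [|j].
  have [q qZ Zq] := Zd iN As; exists q => // s' As'.
  by rewrite opprB addrA subrK; exact: Zq.
(* Once differentiated in t, the increment no longer depends on s. *)
exists (fun=> 0); first by apply: ms_cvg_cst; exact: L2_0.
by move=> s' As'; rewrite subrr scaler0.
Qed.

(** Exchanging s and t changes the sign of both increments. This symmetry reduces derivatives in t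
    to derivatives in s. *)
Lemma atomC i j i' j' s t : atom i j i' j' s t = atom j i j' i' t s.
Proof.
have E k l : incr k l s t = - incr l k t s by rewrite /incr opprB.
by rewrite /atom !E /ip mulrNN.
Qed.

Lemma atom_CS i j i' j' s t : (i <= N)%N -> (j <= N)%N -> (i' <= N)%N ->
  (j' <= N)%N -> A s -> A t ->
  atom i j i' j' s t ^+ 2 <= atom i j i j s t * atom i' j' i' j' s t.
Proof. by move=> *; rewrite ip_cauchy_schwarz// incr_L2. Qed.

Lemma atom_cvg i j i' j' s t : (i <= N)%N -> (j <= N)%N -> (i' <= N)%N ->
  (j' <= N)%N -> A s -> A t ->
  jcvg A (fun=> atom i j i' j') (atom i j i' j' s t) s t.
Proof. by move=> *; apply: ms_cvg_ip; exact: incr_cvg. Qed.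

Lemma atom_ds i j i' j' s t : (i < N)%N -> (j <= N)%N -> (i' < N)%N ->
  (j' <= N)%N -> A s -> A t ->
  dwithin A (atom i j i' j' ^~ t)
    (atom i.+1 j i' j' s t + atom i j i'.+1 j' s t) s.
Proof.
move=> iN jN i'N j'N As At; apply: dwithin_ip => //.
- by rewrite incr_L2// ltnW.
- by move=> s' As'; rewrite incr_L2// ltnW.
- by move=> s' As'; rewrite incr_L2// ltnW.
- exact: incr_ds.
- exact: incr_ds.
Qed.

End MeanSquareKernel.

(** * Completely monotone functions near 0 *)

Section CompletelyMonotone.
Context (R : realType) (psi : R -> R).
Hypothesis cm : completely_monotone psi.

Lemma cm_is_derive k (u : R) : 0 < u ->
  is_derive u 1 (derive1n k psi) (derive1n k.+1 psi u).
Proof.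
move=> u0; have [d _] := cm.2 k u u0.
by apply: DeriveDef => //; rewrite derive1nS derive1E.
Qed.

(** On the positive reals these signed derivatives are nonnegative and nonincreasing, and [phi k]
    has derivative - [phi k.+1]: the parity of k disappears from the estimates. *)
Let phi k (u : R) : R := (-1) ^+ k * derive1n k psi u.

Let phi_ge0 k (u : R) : 0 < u -> 0 <= phi k u.
Proof. by move=> /(cm.2 k)[]. Qed.

Let phi_MVT k (a b : R) : 0 < a -> a < b ->
  exists2 c : R, a < c < b & phi k a - phi k b = phi k.+1 c * (b - a).
Proof.
move=> a0 ab.
have dphi x : a <= x -> is_derive x 1 (phi k) (- phi k.+1 x).
  move=> ax; have x0 : 0 < x by exact: lt_le_trans ax.
  have dk := cm_is_derive k x0.
  have H : is_derive x 1 ((-1) ^+ k \*: derive1n k psi)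
    ((-1) ^+ k *: derive1n k.+1 psi x) by exact: is_deriveZ.
  apply: (is_derive_eq H).
  by rewrite /phi exprS -[LHS]/(_ * _); ring.
have [||c] := @MVT R (phi k) (fun x => - phi k.+1 x) a b ab.
- by move=> x; rewrite in_itv/= => /andP[/ltW ax _]; exact: dphi.
- apply: derivable_within_continuous => x; rewrite in_itv/= => /andP[ax _].
  by have [] := dphi x ax.
by rewrite in_itv/= => cab E; exists c => //; rewrite -opprB E; ring.
Qed.

Let phi_noninc k (a b : R) : 0 < a -> a <= b -> phi k b <= phi k a.
Proof.
move=> a0; rewrite le_eqVlt => /orP[/eqP -> //|ab].
have [c /andP[ac _] E] := phi_MVT k a0 ab.
by rewrite -subr_ge0 E mulr_ge0 ?phi_ge0 ?subr_ge0 ?ltW// (lt_trans a0).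
Qed.

Let phi_cvg k (C : R) : (forall u : R, 0 < u -> phi k u <= C) ->
  exists l : R, phi k u @[u --> (0 : R)^'+] --> l.
Proof.
move=> bC; eexists; apply: (@nonincreasing_at_right_cvgr _ _ 0 (BLeft 1)).
- by rewrite bnd_simp.
- move=> x y; rewrite !in_itv/= => /andP[x0 _] _ xy; exact: phi_noninc.
- exists C => _ [x + <-]; rewrite /= in_itv/= => /andP[x0 _]; exact: bC.
Qed.

Variables (N : nat) (l : R).
Hypothesis hl : derive1n N psi u @[u --> (0 : R)^'+] --> l.

Let phiN_cvg : phi N u @[u --> (0 : R)^'+] --> (-1) ^+ N * l.
Proof. by apply: cvgM => //; exact: cvg_cst. Qed.

(** Downward from N, where the limit at 0+ bounds the nonincreasing [phi N]: if C bounds [phi k.+1],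
    the mean value theorem on [u, 1] bounds [phi k u] by [phi k 1 + C]. *)
Let phi_bound k : (k <= N)%N -> exists C : R, forall u : R, 0 < u -> phi k u <= C.
Proof.
move=> kN; have [j ->] : exists j, k = (N - j)%N by exists (N - k)%N; lia.
elim: j => [|j [C HC]].
  exists ((-1) ^+ N * l) => u u0; rewrite subn0.
  apply: (cvgr_to_ge phiN_cvg); near=> v; apply: phi_noninc => //.
  by near: v; exact: nbhs_right_le.
(* The subtraction is truncated: from j = N on, the index stays at 0 and the previous bound still
   serves. *)
have [jN|jN] := leqP N j.
  by exists C => u; rewrite (_ : (N - j.+1 = N - j)%N); [exact: HC|lia].
exists (phi (N - j.+1) 1 + C) => u u0.
have [u1|u1] := leP 1 u.
  apply: (@le_trans _ _ (phi (N - j.+1) 1)); first exact: phi_noninc.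
  by rewrite lerDl; apply: le_trans (HC 1 _) => //; exact: phi_ge0.
have [c /andP[uc c1]] := phi_MVT (N - j.+1) u0 u1.
rewrite -subSn// subSS => E.
have c0 := lt_trans u0 uc.
have := HC c c0; have := phi_ge0 (N - j) c0.
move: E; nra.
Unshelve. all: by end_near. Qed.

Lemma cm_lim k : (k <= N)%N ->
  exists m : R, derive1n k psi u @[u --> (0 : R)^'+] --> m.
Proof.
move=> /phi_bound[C /phi_cvg[m Hm]]; exists ((-1) ^+ k * m).
have -> : derive1n k psi = (fun u => (-1) ^+ k * phi k u).
  by apply/funext => u; rewrite /phi mulrA -expr2 sqrr_sign mul1r.
by apply: cvgM => //; exact: cvg_cst.
Qed.

Let half_right : (u / 2 : R) @[u --> (0 : R)^'+] --> (0 : R)^'+.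
Proof.
move=> U [r /= r0 rU]; exists r => //= u /=; rewrite sub0r normrN => ur u0.
apply: rU => /=; last by rewrite divr_gt0.
rewrite sub0r normrN gtr0_norm ?divr_gt0//.
by move: ur; rewrite gtr0_norm// => ur; lra.
Qed.

(** Monotonicity on [u / 2, u] gives (u / 2) phi_(k+1) (u) <= phi_k (u / 2) - phi_k (u). Hence u ^ i
    phi_(N+i) (u) -> 0 for i >= 1 by induction: at i = 1 the right-hand side is an increment of the
    convergent phi_N, and later it is at most phi_k (u / 2), to which the induction hypothesis
    applies. Squaring removes the sign. *)
Lemma cm_small j : (0 < j)%N ->
  derive1n (N + j)%N psi u ^+ 2 * u ^+ (j + j) @[u --> (0 : R)^'+] --> (0 : R).
Proof.
have H i : u ^+ i.+1 * phi (N + i.+1)%N u @[u --> (0 : R)^'+] --> (0 : R).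
  elim: i => [|i IH].
    have c2 : 2 * (phi N (u / 2) - phi N u) @[u --> (0 : R)^'+] --> (0 : R).
      rewrite [X in _ --> X](_ : 0 = 2 * ((-1) ^+ N * l - (-1) ^+ N * l)); last by ring.
      apply: cvgM; first exact: cvg_cst.
      by apply: cvgB => //; exact: (cvg_comp _ _ half_right phiN_cvg).
    apply: squeeze_cvgr (cvg_cst _) c2; near=> u.
    have u0 : 0 < u by [].
    have u20 : 0 < u / 2 by rewrite divr_gt0.
    have u2u : u / 2 < u by lra.
    have [c /andP[uc cu] ->] := phi_MVT N u20 u2u.
    have := phi_noninc N.+1 (lt_trans u20 uc) (ltW cu).
    rewrite addn1 expr1 => hc; have := phi_ge0 N.+1 u0 => hu.
    by rewrite (mulr_ge0 (ltW u0) hu)/=; nra.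
  (* One factor 2 comes from the length u / 2 of the interval, the power of 2 from replacing u by u
     / 2 in the monomial. *)
  have c2 : 2 * 2 ^+ i.+1 * ((u / 2) ^+ i.+1 * phi (N + i.+1) (u / 2))
      @[u --> (0 : R)^'+] --> (0 : R).
    rewrite [X in _ --> X](_ : 0 = 2 * 2 ^+ i.+1 * 0); last by ring.
    apply: cvgM; first exact: cvg_cst.
    exact: (cvg_comp _ _ half_right IH).
  apply: squeeze_cvgr (cvg_cst _) c2; near=> u.
  have u0 : 0 < u by [].
  have u20 : 0 < u / 2 by rewrite divr_gt0.
  have u2u : u / 2 < u by lra.
  rewrite (mulr_ge0 (exprn_ge0 _ (ltW u0)) (phi_ge0 _ u0))/=.
  have [c /andP[uc cu] E] := phi_MVT (N + i.+1) u20 u2u.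
  have hc := phi_noninc (N + i.+1).+1 (lt_trans u20 uc) (ltW cu).
  have hu := phi_ge0 (N + i.+1) u0.
  rewrite mulrA -(mulrA 2) -exprMn [2 * (u / 2)]mulrC divfK// (exprS u i.+1).
  rewrite -!mulrA mulrCA -[leLHS]mulrCA.
  rewrite (mulrCA 2) mulrCA ler_wpM2l ?exprn_ge0 ?(ltW u0)// addnS.
  by move: E hc; nra.
case: j => // j _.
rewrite [X in X @ _ --> _](_ : _ = (fun u =>
    (u ^+ j.+1 * phi (N + j.+1)%N u) * (u ^+ j.+1 * phi (N + j.+1)%N u))).
  rewrite [X in _ --> X](_ : 0 = 0 * 0); last by rewrite mulr0.
  by apply: cvgM; exact: H.
apply/funext => u; rewrite /phi exprD.
set a := derive1n _ _ _; set b := u ^+ _.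
rewrite [RHS](_ : _ = ((-1) ^+ (N + j.+1)) ^+ 2 * (a ^+ 2 * (b * b))).
  by rewrite sqrr_sign mul1r.
by ring.
Unshelve. all: by end_near. Qed.

Lemma cm_cvg0 : psi u @[u --> (0 : R)^'+] --> psi 0.
Proof.
have /subspace_continuousP/(_ 0) := cm.1.
rewrite /= in_itv/= lexx => /(_ isT) H.
apply: cvg_trans H; apply: cvg_app => U UA.
have AU : \forall y \near (0 : R), `[0, +oo[%classic y -> U y by exact: UA.
suff: \forall y \near (0 : R), 0 < y -> U y by [].
by apply: filterS AU => y; rewrite /= in_itv/= andbT => + /ltW; exact.
Qed.

End CompletelyMonotone.

(** * Derivatives of psi (gamma (s, t)) *)

Section KernelCalculus.
Context (R : realType) (A : set R) (N : nat).

Variable at_ : nat -> nat -> nat -> nat -> R -> R -> R.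
Hypotheses
  (atC : forall i j i' j' s t, at_ i j i' j' s t = at_ j i j' i' t s)
  (at_ge0 : forall i j s t, 0 <= at_ i j i j s t)
  (at_CS : forall i j i' j' s t, (i <= N)%N -> (j <= N)%N -> (i' <= N)%N ->
     (j' <= N)%N -> A s -> A t ->
     at_ i j i' j' s t ^+ 2 <= at_ i j i j s t * at_ i' j' i' j' s t)
  (at_cvg : forall i j i' j' s t, (i <= N)%N -> (j <= N)%N -> (i' <= N)%N ->
     (j' <= N)%N -> A s -> A t ->
     jcvg A (fun=> at_ i j i' j') (at_ i j i' j' s t) s t)
  (at_ds : forall i j i' j' s t, (i < N)%N -> (j <= N)%N -> (i' < N)%N ->
     (j' <= N)%N -> A s -> A t ->
     dwithin A (at_ i j i' j' ^~ t)
       (at_ i.+1 j i' j' s t + at_ i j i'.+1 j' s t) s).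

(* Sums of products of atoms; a and b bound the total orders of the derivatives
   in s and in t, and every product has at least w undifferentiated factors
   Z_s - Z_t, each of which contributes a square root of gamma to its size. *)
Inductive atom_poly : nat -> nat -> nat -> (R -> R -> R) -> Prop :=
| atom_poly_cst c a b : atom_poly a b 0 (fun _ _ => c)
| atom_poly_atom i j i' j' a b w a' b' w' M : atom_poly a b w M ->
    (a + i + i' <= a')%N -> (b + j + j' <= b')%N ->
    (w' <= w + (i + j == 0) + (i' + j' == 0))%N ->
    atom_poly a' b' w' (fun s t => at_ i j i' j' s t * M s t)
| atom_poly_add a b w M M' : atom_poly a b w M -> atom_poly a b w M' ->
    atom_poly a b w (fun s t => M s t + M' s t).

Lemma atom_poly_swap a b w M : atom_poly a b w M -> atom_poly b a w (fun s t => M t s).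
Proof.
elim=> {a b w M} [c a b|i j i' j' a b w a' b' w' M _ IH ha hb hw|
  a b w M M' _ IH _ IH'].
- exact: atom_poly_cst.
- rewrite (_ : (fun s t => _) = (fun s t => at_ j i j' i' s t * M t s)).
    by apply: (atom_poly_atom IH) => //; rewrite (addnC j) (addnC j').
  by apply/funext => s; apply/funext => t; rewrite atC.
- exact: atom_poly_add.
Qed.

Lemma atom_poly_cvg a b w M : atom_poly a b w M -> (a <= N)%N -> (b <= N)%N ->
  forall s t, A s -> A t -> jcvg A (fun=> M) (M s t) s t.
Proof.
elim=> {a b w M} [c a b|i j i' j' a b w a' b' w' M _ IH ha hb hw|
  a b w M M' _ IH _ IH'] aN bN s t As At.
- exact: cvg_cst.
- have ha' := leq_trans ha aN; have hb' := leq_trans hb bN.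
  by apply: cvgM; [apply: at_cvg => //; lia|apply: IH => //; lia].
- by apply: cvgD; [exact: IH|exact: IH'].
Qed.

(** In each product of the Leibniz rule a single increment is differentiated, so at most one
    undifferentiated factor is lost. *)
Lemma atom_poly_ds a b w M : atom_poly a b w M -> (a < N)%N -> (b <= N)%N ->
  exists2 M', atom_poly a.+1 b w.-1 M' &
    forall s t, A s -> A t -> dwithin A (M ^~ t) (M' s t) s.
Proof.
elim=> {a b w M} [c a b|i j i' j' a b w a' b' w' M pM IH ha hb hw|
  a b w M M' _ IH _ IH'] aN bN.
- exists (fun _ _ => 0); first exact: atom_poly_cst.
  by move=> s t _ _; exact: dwithin_cst.
- have [||M' pM' dM] := IH; [lia|lia|].
  exists (fun s t => (at_ i.+1 j i' j' s t * M s t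
    + at_ i j i'.+1 j' s t * M s t) + at_ i j i' j' s t * M' s t).
    apply: atom_poly_add; first apply: atom_poly_add.
    + by apply: (atom_poly_atom pM); lia.
    + by apply: (atom_poly_atom pM); lia.
    + by apply: (atom_poly_atom pM'); lia.
  move=> s t As At; rewrite -mulrDl; apply: dwithinM => //.
    by apply: at_ds => //; lia.
  exact: dM.
- have [//|//|M1 p1 d1] := IH; have [//|//|M2 p2 d2] := IH'.
  exists (fun s t => M1 s t + M2 s t); first exact: atom_poly_add.
  by move=> s t As At; apply: dwithinD; [exact: d1|exact: d2].
Qed.

Local Notation gam := (at_ 0 0 0 0).

Lemma jnbhs_mem s t : \forall p \near jnbhs A s t,
  [/\ A p.1.2, A p.2 & 0 < p.1.1].
Proof.
exists ([set q : R * R | 0 < q.1 /\ A q.2], A) => /=; last first.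
  by move=> [[u s'] t'] /= [[u0 As] At].
split; last by rewrite /within/=; exact: nearW.
exists ([set u : R | 0 < u], A) => //=; split; first exact: nbhs_right_gt.
by rewrite /within/=; exact: nearW.
Qed.

Lemma at_bound i j s t : (i <= N)%N -> (j <= N)%N -> A s -> A t ->
  exists2 K, 0 <= K & \forall p \near jnbhs A s t, at_ i j i j p.1.2 p.2 <= K.
Proof.
move=> iN jN As At; exists (at_ i j i j s t + 1); first by rewrite addr_ge0.
have := at_cvg iN jN iN jN As At => /cvgrPdist_lt /(_ 1 ltr01).
by apply: filterS => p; rewrite distrC ltr_norml => /andP[_]; lra.
Qed.

(** Cauchy-Schwarz bounds the square of an atom by the squared norms of its two increments; each of
    these is gamma if the increment is undifferentiated, and locally bounded otherwise. *)
Lemma atom_poly_bound a b w M : atom_poly a b w M -> (a <= N)%N -> (b <= N)%N ->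
  forall s t, A s -> A t -> exists2 C, 0 <= C &
    \forall p \near jnbhs A s t, M p.1.2 p.2 ^+ 2 <= C * gam p.1.2 p.2 ^+ w.
Proof.
elim=> {a b w M} [c a b|i j i' j' a b w a' b' w' M pM IH ha hb hw|
  a b w M M' _ IH _ IH'] aN bN s t As At.
- exists (c ^+ 2); first exact: sqr_ge0.
  by apply: nearW => p; rewrite mulr1.
- have {IH}[||C C0 HC] := IH _ _ s t As At; [lia|lia|].
  have [G G0 HG] := at_bound (leq0n N) (leq0n N) As At.
  have bnd x y : (x <= N)%N -> (y <= N)%N -> exists2 K, 0 <= K &
      \forall p \near jnbhs A s t,
        at_ x y x y p.1.2 p.2 <= K * gam p.1.2 p.2 ^+ (x + y == 0)%N.
    move=> xN yN; case: eqP => [xy|_].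
      exists 1; first exact: ler01.
      have [-> ->] : x = 0%N /\ y = 0%N by lia.
      by apply: nearW => p; rewrite mul1r expr1.
    have [K K0 HK] := at_bound xN yN As At; exists K => //.
    by apply: filterS HK => p; rewrite mulr1.
  have [||K K0 HK] := bnd i j; [lia|lia|].
  have [||K' K'0 HK'] := bnd i' j'; [lia|lia|].
  (* The weight is only a lower bound on the number of undifferentiated factors; the d surplus
     powers of gamma are absorbed by the local bound G. *)
  have [d wE] : exists d, (w + (i + j == 0) + (i' + j' == 0) = w' + d)%N.
    by exists (w + (i + j == 0) + (i' + j' == 0) - w')%N; rewrite subnKC.
  exists (K * K' * C * G ^+ d); first by rewrite !mulr_ge0// exprn_ge0.
  near=> p.
  have [Ap1 Ap2 _] : [/\ A p.1.2, A p.2 & 0 < p.1.1].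
    by near: p; exact: jnbhs_mem.
  have g0 := at_ge0 0 0 p.1.2 p.2.
  have h1 : at_ i j i j p.1.2 p.2 <= K * gam p.1.2 p.2 ^+ (i + j == 0)%N
    by near: p.
  have h2 : at_ i' j' i' j' p.1.2 p.2 <= K' * gam p.1.2 p.2 ^+ (i' + j' == 0)%N
    by near: p.
  have h3 : M p.1.2 p.2 ^+ 2 <= C * gam p.1.2 p.2 ^+ w by near: p.
  have h4 : gam p.1.2 p.2 <= G by near: p.
  rewrite exprMn.
  apply: (@le_trans _ _ ((K * gam p.1.2 p.2 ^+ (i + j == 0)%N) *
     (K' * gam p.1.2 p.2 ^+ (i' + j' == 0)%N) * (C * gam p.1.2 p.2 ^+ w))).
    apply: ler_pM; rewrite ?sqr_ge0//.
    apply: le_trans (at_CS _ _ _ _ Ap1 Ap2) _; try lia.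
    by apply: ler_pM.
  rewrite [leLHS](_ : _ = K * K' * C * gam p.1.2 p.2 ^+ (w' + d)%N); last first.
    by rewrite -wE !exprD; ring.
  rewrite exprD mulrA mulrAC ler_wpM2r ?exprn_ge0//.
  by rewrite ler_wpM2l ?mulr_ge0// lerXn2r ?nnegrE.
- have [C1 C10 H1] := IH aN bN s t As At.
  have [C2 C20 H2] := IH' aN bN s t As At.
  exists (2 * C1 + 2 * C2); first by rewrite addr_ge0// mulr_ge0.
  near=> p.
  have h1 : M p.1.2 p.2 ^+ 2 <= C1 * gam p.1.2 p.2 ^+ w by near: p.
  have h2 : M' p.1.2 p.2 ^+ 2 <= C2 * gam p.1.2 p.2 ^+ w by near: p.
  have := sqr_ge0 (M p.1.2 p.2 - M' p.1.2 p.2); nra.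
Unshelve. all: by end_near. Qed.

Variable psi : nat -> R -> R.
Hypotheses
  (psi_der : forall k (u : R), 0 < u -> is_derive u 1 (psi k) (psi k.+1 u))
  (psi_lim : forall k, (k <= N)%N -> exists l : R, psi k u @[u --> (0 : R)^'+] --> l)
  (psi_small : forall j, (0 < j)%N ->
     psi (N + j)%N u ^+ 2 * u ^+ (j + j) @[u --> (0 : R)^'+] --> (0 : R)).

(* The condition on k is the balance that survives differentiation: the
   derivatives of psi that blow up at 0, those with k > N >= (a + b) / 2, come
   with a factor M that is O(gamma ^ (k - N)). The shift by e keeps the argument
   of psi positive. *)
Inductive kern : nat -> nat -> (R -> R -> R -> R) -> Prop :=
| kern_term k a b w M : atom_poly a b w M -> (k + k <= a + b + w)%N ->
    kern a b (fun e s t => psi k (gam s t + e) * M s t)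
| kern_add a b F F' : kern a b F -> kern a b F' ->
    kern a b (fun e s t => F e s t + F' e s t).

Lemma kern_swap a b F : kern a b F -> kern b a (fun e s t => F e t s).
Proof.
elim=> {a b F} [k a b w M pM hk|a b F F' _ IH _ IH'].
- rewrite (_ : (fun e s t => _) = (fun e s t => psi k (gam s t + e) * M t s)).
    by apply: (kern_term (atom_poly_swap pM)); rewrite (addnC b).
  by do 3!apply/funext => ?; rewrite atC.
- exact: kern_add.
Qed.

(** Both terms of the product rule keep the balance. Differentiating psi raises k and a by one and
    brings a first derivative of gamma, which raises w by one; differentiating M raises a by one and
    lowers w by at most one. *)
Lemma kern_ds a b F : kern a b F -> (a < N)%N -> (b <= N)%N ->
  exists2 F', kern a.+1 b F' & forall e, 0 < e ->
    forall s t, A s -> A t -> dwithin A (F e ^~ t) (F' e s t) s.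
Proof.
elim=> {a b F} [k a b w M pM hk|a b F F' _ IH _ IH'] aN bN.
- have [M' pM' dM] := atom_poly_ds pM aN bN.
  exists (fun e s t => psi k.+1 (gam s t + e) *
      (at_ 1 0 0 0 s t * M s t + at_ 0 0 1 0 s t * M s t)
    + psi k (gam s t + e) * M' s t).
    apply: kern_add.
      apply: (@kern_term _ _ _ w.+1); last lia.
      by apply: atom_poly_add; apply: (atom_poly_atom pM); lia.
    by apply: (kern_term pM'); lia.
  move=> e e0 s t As At.
  rewrite -mulrDl mulrA; apply: dwithinM => //; last exact: dM.
  apply: (@dwithin_comp _ _ (psi k) (fun s => gam s t + e)) => //.
    by apply: psi_der; rewrite ltr_wpDl.
  rewrite -[X in dwithin _ _ X](addr0); apply: dwithinD; last exact: dwithin_cst.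
  by apply: at_ds => //; lia.
- have [//|//|F1 p1 d1] := IH; have [//|//|F2 p2 d2] := IH'.
  exists (fun e s t => F1 e s t + F2 e s t); first exact: kern_add.
  by move=> e e0 s t As At; apply: dwithinD; [exact: d1|exact: d2].
Qed.

Lemma kern_dt a b F : kern a b F -> (a <= N)%N -> (b < N)%N ->
  exists2 F', kern a b.+1 F' & forall e, 0 < e ->
    forall s t, A s -> A t -> dwithin A (F e s) (F' e s t) t.
Proof.
move=> /kern_swap CF aN bN; have [F' CF' dF'] := kern_ds CF bN aN.
exists (fun e s t => F' e t s); first exact: kern_swap.
by move=> e e0 s t As At; exact: dF'.
Qed.

Lemma gam_eps_cvg s t : A s -> A t ->
  gam p.1.2 p.2 + p.1.1 @[p --> jnbhs A s t] --> gam s t.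
Proof.
move=> As At; rewrite -[X in _ --> X]addr0; apply: cvgD; first exact: at_cvg.
have H : (p.1.1 : R) @[p --> jnbhs A s t] --> 0^'+.
  exact: (cvg_comp _ _ cvg_fst cvg_fst).
by apply: cvg_trans H _; exact: cvg_within.
Qed.

(** The shift keeps the argument of psi positive, so at a zero of gamma the limits of psi and its
    derivatives at 0+ apply. *)
Lemma gam_eps_right s t : A s -> A t -> gam s t = 0 ->
  gam p.1.2 p.2 + p.1.1 @[p --> jnbhs A s t] --> 0^'+.
Proof.
move=> As At g0 U; have := gam_eps_cvg As At; rewrite g0 => c0.
move=> UU; have {}UU : \forall u \near (0 : R), 0 < u -> U u by exact: UU.
have H := c0 _ UU.
suff : \forall p \near jnbhs A s t, U (gam p.1.2 p.2 + p.1.1) by [].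
near=> p.
have : 0 < gam p.1.2 p.2 + p.1.1 -> U (gam p.1.2 p.2 + p.1.1) by near: p.
apply.
have [_ _ ?] : [/\ A p.1.2, A p.2 & 0 < p.1.1] by near: p; exact: jnbhs_mem.
by rewrite ltr_wpDl.
Unshelve. all: by end_near. Qed.

Lemma psi_gam_cvg k s t : A s -> A t -> 0 < gam s t ->
  jcvg A (fun e s t => psi k (gam s t + e)) (psi k (gam s t)) s t.
Proof.
move=> As At g0; apply: (cvg_comp _ _ (gam_eps_cvg As At)).
have [d _] := psi_der k g0.
have /derivable1_diffP /differentiable_continuous H := d.
exact: H.
Qed.

(** Only a zero of gamma combined with k > N is delicate. There k = N + j and a, b <= N force w >= 2
    j, so with v = gamma + e the square of the term is at most C psi^(N+j) (v) ^ 2 v ^ (2 j), which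
    tends to 0. *)
Lemma kern_cvg a b F : kern a b F -> (a <= N)%N -> (b <= N)%N ->
  forall s t, A s -> A t -> exists l, jcvg A F l s t.
Proof.
elim=> {a b F} [k a b w M pM hk|a b F F' _ IH _ IH'] aN bN s t As At; last first.
  have [l H] := IH aN bN s t As At.
  have [l' H'] := IH' aN bN s t As At.
  by exists (l + l'); apply: cvgD.
have cM := atom_poly_cvg pM aN bN As At.
have := at_ge0 0 0 s t; rewrite le_eqVlt => /orP[/eqP/esym g0|g0]; last first.
  exists (psi k (gam s t) * M s t); apply: cvgM => //; exact: psi_gam_cvg.
have cg := gam_eps_right As At g0.
have [kN|Nk] := leqP k N.
  have [l Hl] := psi_lim kN; exists (l * M s t).
  by apply: cvgM => //; exact: (cvg_comp _ _ cg Hl).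
have [j kE] : exists j, k = (N + j)%N by exists (k - N)%N; rewrite subnKC// ltnW.
have j0 : (0 < j)%N by lia.
rewrite {}kE in hk *.
exists 0; have [C C0 HC] := atom_poly_bound pM aN bN As At.
pose v (p : R * R * R) := gam p.1.2 p.2 + p.1.1.
have cs : C * (psi (N + j)%N (v p) ^+ 2 * v p ^+ (j + j))
    @[p --> jnbhs A s t] --> 0.
  rewrite [X in _ --> X](_ : 0 = C * 0); last by rewrite mulr0.
  apply: cvgM; first exact: cvg_cst.
  exact: (cvg_comp _ _ cg (psi_small j0)).
have sq : (psi (N + j)%N (v p) * M p.1.2 p.2) ^+ 2 @[p --> jnbhs A s t] --> 0.
  apply: squeeze_cvgr (cvg_cst _) cs.
  (* Needed to lower the exponent from w to 2 j. *)
  have v1 : \forall p \near jnbhs A s t, v p <= 1.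
    have : \forall u \near (0 : R)^'+, u <= 1 by exact: nbhs_right_le.
    exact: cg.
  near=> p; rewrite sqr_ge0/=.
  have [Ap1 Ap2 e0] : [/\ A p.1.2, A p.2 & 0 < p.1.1].
    by near: p; exact: jnbhs_mem.
  have h3 : M p.1.2 p.2 ^+ 2 <= C * gam p.1.2 p.2 ^+ w by near: p.
  have v1p : v p <= 1 by near: p.
  have gv : gam p.1.2 p.2 <= v p by rewrite /v lerDl ltW.
  have gp := at_ge0 0 0 p.1.2 p.2.
  have vp : 0 <= v p by exact: le_trans gv.
  rewrite exprMn [leRHS]mulrCA ler_wpM2l ?sqr_ge0//.
  apply: le_trans h3 _; rewrite ler_wpM2l//.
  apply: (@le_trans _ _ (v p ^+ w)); first by rewrite lerXn2r ?nnegrE.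
  by apply: ler_wiXn2l => //; lia.
apply/norm_cvg0P.
have := cvg_comp _ _ sq (@sqrt_continuous R 0).
rewrite sqrtr0; apply: cvg_trans; apply: near_eq_cvg; apply: nearW => p.
by rewrite /= sqrtr_sqr.
Unshelve. all: by end_near. Qed.

End KernelCalculus.

(** * The Schoenberg transform *)

Section Schoenberg.
Context (R : realType) (disp disp' : measure_display)
  (T : measurableType disp) (P : probability T R)
  (T' : measurableType disp') (P' : probability T' R)
  (psi : R -> R).
Hypothesis cm : completely_monotone psi.

Lemma ms_Cn_Sch (A : set R) (n : nat) (l : R) (f : R -> T -> R)
    (g : R -> T' -> R) :
  is_interval A -> (exists a b, [/\ A a, A b & a != b]) ->
  derive1n n psi u @[u --> (0 : R)^'+] --> l ->
  (forall t, A t -> f t \in Lfun P 2%:E) -> ms_Cn_on P n A f ->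
  (forall t, A t -> g t \in Lfun P' 2%:E) ->
  (forall s t, A s -> A t ->
     ip P' (g s) (g t) = psi (ip P (f s - f t) (f s - f t))) ->
  ms_Cn_on P' n A g.
Proof.
move=> iA A2 hl fL fC gL gk.
have [Z [Z0 ZL Zd Zc]] := ms_Cn_derivs fL fC.
pose at_ := atom P Z; pose psin k := derive1n k psi.
have atE s t : at_ 0%N 0%N 0%N 0%N s t = ip P (f s - f t) (f s - f t).
  by rewrite /at_ /atom /incr Z0.
have at0 i j s t : 0 <= at_ i j i j s t by exact: ip_ge0.
have der k (u : R) : 0 < u -> is_derive u 1 (psin k) (psin k.+1 u).
  exact: cm_is_derive.
(* The factor 1 is a constant atom polynomial, giving the regularized kernel the shape of a
   [kern_term]. *)
pose F (e s t : R) := psin 0%N (at_ 0%N 0%N 0%N 0%N s t + e) * 1.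
apply: (@ms_Cn_of_kernel _ _ _ P' A iA A2 n (fun k => kern at_ psin k k)
  _ _ n 0%N F (fun s t => psi (ip P (f s - f t) (f s - f t))) g).
- move=> k G kn CG s t As At.
  apply: (kern_cvg (A := A) (N := n) _ _ _ der _ _ CG) => //.
  + exact: atom_CS.
  + exact: atom_cvg.
  + by move=> j; exact: cm_lim hl _.
  + by move=> j; exact: cm_small hl _.
- move=> k G kn CG.
  have dS := atom_ds ZL Zd.
  have [F1 C1 d1] : exists2 F1, kern at_ psin k.+1 k F1 & forall e, 0 < e ->
      forall s t, A s -> A t -> dwithin A (G e ^~ t) (F1 e s t) s.
    apply: (kern_ds (N := n)) => //; exact: ltnW.
  have [F2 C2 d2] : exists2 F2, kern at_ psin k.+1 k.+1 F2 & forall e, 0 < e ->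
      forall s t, A s -> A t -> dwithin A (F1 e s) (F2 e s t) t.
    by apply: (kern_dt (N := n) (atomC P Z)).
  by exists F1, F2.
- by rewrite add0n.
- exact: (@kern_term _ at_ psin 0 0 0 0 (fun _ _ => 1) (atom_poly_cst at_ 1 0 0)).
- move=> s t As At; rewrite -atE -[X in jcvg _ _ X]mulr1.
  apply: cvgM; last exact: cvg_cst.
  have := at0 0%N 0%N s t; rewrite le_eqVlt => /orP[/eqP/esym g0|g0].
    (* At a zero of gamma, the continuity of psi at 0 identifies the limit as psi 0. *)
    have := gam_eps_right at0 (atom_cvg Zc) As At g0.
    by rewrite g0 => cg; exact: (cvg_comp _ _ cg (cm_cvg0 cm)).
  exact: (psi_gam_cvg (k := 0) (atom_cvg Zc) der As At g0).
- exact: gL.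
- exact: gk.
Qed.

(** By the mean value theorem the slope at v is a value of psi' strictly between 0 and v. *)
Lemma cm_slope0 (l : R) : derive1n 1 psi u @[u --> (0 : R)^'+] --> l ->
  (psi u - psi 0) / u @[u --> (0 : R)^'+] --> l.
Proof.
move=> hl; apply/cvgrPdist_lt => e e0.
move/cvgrPdist_lt : hl => /(_ e e0)[r /= r0 H].
exists r => //= v /=; rewrite sub0r normrN => vr v0.
have [||c] := @MVT R psi (derive1n 1 psi) 0 v v0.
- move=> x; rewrite in_itv/= => /andP[x0 _].
  exact: (cm_is_derive cm 0 x0).
- apply: continuous_subspaceW cm.1 => x; rewrite /= !in_itv/= => /andP[-> _] //.
rewrite in_itv/= subr0 => /andP[c0 cv] ->; rewrite mulfK ?gt_eqF//.
apply: H => //=; rewrite sub0r normrN gtr0_norm//.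
by apply: lt_trans cv _; rewrite gtr0_norm in vr.
Qed.

(** The value l at 0 makes the first-order expansion of psi exact at every v, including when a
    squared increment of the process vanishes for some h > 0. *)
Let q (l v : R) := if v == 0 then l else (psi v - psi 0) / v.

Let psi_q l v : psi v = psi 0 + q l v * v.
Proof.
rewrite /q; case: eqP => [->|/eqP v0]; first by rewrite mulr0 addr0.
by rewrite divfK// addrC subrK.
Qed.

Let q_cvg (l : R) (v : R -> R) : derive1n 1 psi u @[u --> (0 : R)^'+] --> l ->
  (forall h, 0 <= v h) -> v h @[h --> (0 : R)^'+] --> (0 : R) ->
  q l (v h) @[h --> (0 : R)^'+] --> l.
Proof.
move=> /cm_slope0 hl v0 cv; apply/cvgrPdist_lt => e e0.
move/cvgrPdist_lt : hl => /(_ e e0)[r /= r0 H].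
move/cvgr0Pnorm_lt : cv => /(_ r r0); apply: filterS => h vr.
rewrite /q; case: eqP => [_|/eqP vh]; first by rewrite subrr normr0.
by apply: H; rewrite /= ?sub0r ?normrN// lt_def vh v0.
Qed.

(* To first order, psi (h ^ 2 v) = psi 0 + psi'(0+) h ^ 2 v; polarization turns
   the mixed second difference into an inner product. *)
Lemma Sch_exit_ip (l : R) (X X' : R -> T -> R) (Y Y' : R -> T' -> R)
    (x W W' : T -> R) (y V V' : T' -> R) :
  derive1n 1 psi u @[u --> (0 : R)^'+] --> l ->
  x \in Lfun P 2%:E -> (forall h, X h \in Lfun P 2%:E) ->
  (forall h, X' h \in Lfun P 2%:E) ->
  y \in Lfun P' 2%:E -> (forall h, Y h \in Lfun P' 2%:E) ->
  (forall h, Y' h \in Lfun P' 2%:E) ->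
  (forall h, ip P' (Y h) (Y' h) = psi (ip P (X h - X' h) (X h - X' h))) ->
  (forall h, ip P' (Y h) y = psi (ip P (X h - x) (X h - x))) ->
  (forall h, ip P' y (Y' h) = psi (ip P (x - X' h) (x - X' h))) ->
  ip P' y y = psi 0 ->
  ms_cvg P 0^'+ (fun h => h^-1 *: (X h - x)) W ->
  ms_cvg P 0^'+ (fun h => h^-1 *: (X' h - x)) W' ->
  ms_cvg P' 0^'+ (fun h => h^-1 *: (Y h - y)) V ->
  ms_cvg P' 0^'+ (fun h => h^-1 *: (Y' h - y)) V' ->
  ip P' V V' = - 2 * l * ip P W W'.
Proof.
move=> hl xL XL X'L yL YL Y'L YY' Yy yY' yy cX cX' cY cY'.
have [[_ WL _] [_ W'L _]] := (cX, cX').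
have cl : ip P' (h^-1 *: (Y h - y)) (h^-1 *: (Y' h - y)) @[h --> 0^'+]
    --> ip P' V V' by exact: ms_cvg_ip cY cY'.
apply: (cvg_unique _ cl) => //=.
(* The arguments of psi are h ^ 2 times a convergent squared norm, so they tend to 0 and the
   quotient q tends to l. *)
have sm (U : R -> T -> R) (U0 : T -> R) : ms_cvg P 0^'+ U U0 ->
    q l (h ^+ 2 * ip P (U h) (U h)) * ip P (U h) (U h) @[h --> 0^'+]
    --> l * ip P U0 U0.
  move=> cU; have cUU : ip P (U h) (U h) @[h --> 0^'+] --> ip P U0 U0.
    exact: ms_cvg_ip.
  apply: cvgM => //; apply: (q_cvg hl) => [h|].
    by rewrite mulr_ge0 ?sqr_ge0 ?ip_ge0.
  rewrite [X in _ --> X](_ : 0 = 0 ^+ 2 * ip P U0 U0); last by rewrite expr0n mul0r.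
  apply: cvgM => //; apply: (@cvg_within_filter _ _ _ (nbhs 0)).
  exact: exprn_continuous.
pose D h := h^-1 *: (X h - x); pose D' h := h^-1 *: (X' h - x).
have cDD : ms_cvg P 0^'+ (fun h => D h - D' h) (W - W').
  apply: ms_cvgD => //; rewrite -(scaleN1r W').
  under eq_fun do rewrite -scaleN1r.
  by apply: ms_cvgZ => //; exact: cvg_cst.
(* The second difference of the kernel divided by h ^ 2; in the limit, |W - W'| ^ 2 - |W| ^ 2 - |W'|
   ^ 2 is - 2 [ip P W W']. *)
have lim : q l (h ^+ 2 * ip P (D h - D' h) (D h - D' h)) * ip P (D h - D' h) (D h - D' h)
    - q l (h ^+ 2 * ip P (D h) (D h)) * ip P (D h) (D h)
    - q l (h ^+ 2 * ip P (D' h) (D' h)) * ip P (D' h) (D' h) @[h --> 0^'+]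
    --> - 2 * l * ip P W W'.
  rewrite [X in _ --> X](_ : _ = l * ip P (W - W') (W - W') - l * ip P W W
      - l * ip P W' W'); last first.
    by rewrite !(ipBl, ipBr) ?L2B// (ipC P W' W); ring.
  by apply: cvgB; [apply: cvgB|]; exact: sm.
apply: cvg_trans lim; apply: near_eq_cvg; near=> h.
have h0 : h != 0 by rewrite gt_eqF.
have DL : D h \in Lfun P 2%:E by rewrite L2Z// L2B.
have D'L : D' h \in Lfun P 2%:E by rewrite L2Z// L2B.
have XE : X h - x = h *: D h by rewrite scalerA divff// scale1r.
have XE' : X' h - x = h *: D' h by rewrite scalerA divff// scale1r.
have e1 : ip P (X h - X' h) (X h - X' h) = h ^+ 2 * ip P (D h - D' h) (D h - D' h).
  have -> : X h - X' h = h *: (D h - D' h).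
    by rewrite scalerBr -XE -XE' opprB addrA subrK.
  by rewrite ip_scale// L2B.
have e2 : ip P (X h - x) (X h - x) = h ^+ 2 * ip P (D h) (D h).
  by rewrite XE ip_scale.
have e3 : ip P (x - X' h) (x - X' h) = h ^+ 2 * ip P (D' h) (D' h).
  by rewrite ip_distC XE' ip_scale.
rewrite [RHS](_ : _ = h^-1 ^+ 2 * (ip P' (Y h) (Y' h) - ip P' (Y h) y
    - ip P' y (Y' h) + ip P' y y)); last first.
  rewrite !(ipZl, ipZr) ?L2Z ?L2B// !(ipBl, ipBr) ?L2B//; ring.
rewrite YY' Yy yY' yy e1 e2 e3.
set a := ip _ (_ - _) _; set b := ip _ (D h) _; set c := ip _ (D' h) _.
rewrite (psi_q l (h ^+ 2 * a)) (psi_q l (h ^+ 2 * b)) (psi_q l (h ^+ 2 * c)).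
by field.
Unshelve. all: by end_near. Qed.

End Schoenberg.

(** * Centred variables and the variogram *)

Section Centering.
Context (R : realType) (disp : measure_display) (T : measurableType disp)
  (P : probability T R).

Local Notation L2 := (Lfun P 2%:E).
Local Notation ip := (ip P).

Lemma L2_1 : (1 : T -> R) \in L2.
Proof. exact: (Lfun_cst P 1). Qed.

(** [ip f 1] is the mean of f. *)
Definition center (f : T -> R) : T -> R := f - ip f 1 *: (1 : T -> R).

Lemma center_L2 f : f \in L2 -> center f \in L2.
Proof. by move=> fL; rewrite L2B// L2Z// L2_1. Qed.

Lemma centerB f g : f \in L2 -> g \in L2 ->
  center (f - g) = center f - center g.
Proof.
move=> fL gL; rewrite /center ipBl ?L2_1// scalerBl.
by rewrite !opprB addrACA [RHS]addrACA; congr (_ + _); rewrite addrC.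
Qed.

Lemma centerZ c f : f \in L2 -> center (c *: f) = c *: center f.
Proof. by move=> fL; rewrite /center ipZl ?L2_1// scalerBr scalerA. Qed.

Lemma center_sum (I : Type) (r : seq I) (Q : pred I) (F : I -> T -> R) :
  (forall i, Q i -> F i \in L2) ->
  center (\sum_(i <- r | Q i) F i) = \sum_(i <- r | Q i) center (F i).
Proof.
move=> FL; elim: r => [|i r IH].
  by rewrite !big_nil /center ip0l scale0r subr0.
rewrite !big_cons; case: ifP => // Qi; rewrite -IH /center.
by rewrite ipDl ?FL ?L2_sum ?L2_1// scalerDl opprD addrACA.
Qed.

Lemma ms_cvg_center (I : Type) (F : set_system I) {FF : Filter F}
    (X : I -> T -> R) (L : T -> R) :
  ms_cvg P F X L -> ms_cvg P F (center \o X) (center L).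
Proof.
move=> cX; apply: ms_cvgD => //; rewrite -scaleN1r scalerA.
rewrite (_ : (fun i => _) = (fun i => (- 1 * ip (X i) 1) *: (1 : T -> R))); last first.
  by apply/funext => i; rewrite -scaleN1r scalerA.
apply: ms_cvgZ; last by apply: ms_cvg_cst; exact: L2_1.
apply: cvgM; first exact: cvg_cst.
by apply: ms_cvg_ip => //; apply: ms_cvg_cst; exact: L2_1.
Qed.

Lemma ms_Cn_center (n : nat) (A : set R) (f : R -> T -> R) :
  (forall t, A t -> f t \in L2) -> ms_Cn_on P n A f ->
  ms_Cn_on P n A (center \o f).
Proof.
elim: n f => [|n IH] f fL /=.
  by move=> cf t At; apply: ms_cvg_center; exact: cf.
move=> [g fg cg]; exists (center \o g).
  move=> t At; apply: ms_cvg_near (ms_cvg_center (fg t At)).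
  rewrite near_withinE; apply: nearW => s As.
  have E (u v : T -> R) (c : R) : (fun w => (u w - v w) / c) = c^-1 *: (u - v).
    by apply/funext => w; rewrite [LHS]mulrC.
  by rewrite /= !E centerZ ?L2B ?fL// centerB ?fL.
by apply: IH => // t At; have [] := fg t At.
Qed.

Lemma variogram_center (I : Type) (X : I -> T -> R) (i j : I) :
  square_integrable P X ->
  variogram P X i j = ip (center (X i) - center (X j)) (center (X i) - center (X j)).
Proof.
move=> XL; rewrite -centerB; [|exact: XL|exact: XL].
rewrite /variogram /variance covariance.unlock /ip.
have E (f : T -> R) : f \- cst (fine ('E_P[f])%E) = center f.
  apply/funext => w; rewrite /center /ip mulr1 !fctE.
  by congr (_ - _); rewrite -[RHS]/(_ * 1) mulr1.
by rewrite E.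
Qed.

End Centering.

(** * Points of the graph *)

Section SchProcess.
Context (R : realType) (disp disp' : measure_display)
  (T : measurableType disp) (P : probability T R)
  (T' : measurableType disp') (P' : probability T' R)
  (I : Type) (psi : R -> R) (Z : I -> T -> R) (Y : I -> T' -> R).
Hypothesis hY : is_Sch P P' psi Z Y.

Let Y_measurable x : measurable_fun setT (Y x).
Proof.
have [/(_ 1%N (fun=> 1) (fun=> x))[+ _] _ _] := hY.
by congr measurable_fun; apply/funext => w; rewrite big_ord1 mul1r.
Qed.

Let Y_cov x y : ('E_P'[Y x * Y y])%E = (psi (variogram P Z x y))%:E.
Proof.
have [_ Y0 <-] := hY; rewrite covariance.unlock !Y0.
by congr expectation; apply/funext => w; rewrite !fctE /= !subr0.
Qed.

Lemma Sch_L2 x : Y x \in Lfun P' 2%:E.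
Proof. by apply: L2_sqr_lty => //; rewrite Y_cov ltry. Qed.

Lemma Sch_ip x y : ip P' (Y x) (Y y) = psi (variogram P Z x y).
Proof. by rewrite /ip Y_cov. Qed.

End SchProcess.

Lemma le_enat_trans a b c : le_enat a b -> le_enat b c -> le_enat a c.
Proof. by case: a b c => [i|] [j|] [k|] //=; exact: leq_trans. Qed.

Lemma finite_deriv0_le (R : realType) (psi : R -> R) (m : enat) (n : nat) :
  completely_monotone psi -> finite_deriv0 psi m -> le_enat (Fin n) m ->
  exists l : R, derive1n n psi u @[u --> (0 : R)^'+] --> l.
Proof.
case: m => [m|] cm /= hf nm; last exact: hf.
by have [l hl] := hf; exact: cm_lim hl _ nm.
Qed.

(** * Edges seen from one of their points *)

Section GraphPoints.
Context (R : realType) (G : metric_graph R).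

Lemma param_bounds (x : gpoint G) (d : dir G) : stems x d ->
  0 <= param d x <= len d.1.
Proof.
case: x => [v _|e t ht /= /eqP ->]; last by case/andP: ht => /ltW -> /ltW ->.
by rewrite /=; case: ifP => _; rewrite lexx ?andbT ltW// len_gt0.
Qed.

Lemma epoint_endpoint (e : edge G) (t : R) : ~~ (0 < t < len e) ->
  epoint e t = if t <= 0 then Vertex (src e) else Vertex (tgt e).
Proof.
move=> /negP nt; rewrite /epoint.
by destruct (@idP (0 < t < len e)).
Qed.

Lemma epoint_param (v : vertex G) (d : dir G) : stems (Vertex v) d ->
  epoint d.1 (param d (Vertex v)) = Vertex v.
Proof.
by case: d => e [] /= /eqP <-; rewrite epoint_endpoint ?lexx ?ltxx ?andbF//
  leNgt len_gt0.
Qed.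

Definition edge_ball (x : gpoint G) (d : dir G) (r : R) : set R :=
  [set t | 0 <= t <= len d.1 /\ `|t - param d x| < r].

Lemma edge_ball_center (x : gpoint G) (d : dir G) (r : R) : stems x d ->
  0 < r -> edge_ball x d r (param d x).
Proof.
by move=> /param_bounds xd r0; split => //; rewrite subrr normr0.
Qed.

Lemma edge_ball_interval (x : gpoint G) (d : dir G) (r : R) :
  is_interval (edge_ball x d r).
Proof.
move=> a b [/andP[a0 _] ar] [/andP[_ bl] br] c /andP[ac cb].
split; first by rewrite (le_trans a0 ac) (le_trans cb bl).
by move: ar br; rewrite !ltr_norml => /andP[? _] /andP[_ ?]; lra.
Qed.

Lemma edge_ball_nontrivial (x : gpoint G) (d : dir G) (r : R) : stems x d ->
  0 < r -> exists a b, [/\ edge_ball x d r a, edge_ball x d r b & a != b].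
Proof.
move=> xd r0; exists (param d x).
have pA := edge_ball_center xd r0.
have /andP[p0 pl] := param_bounds xd.
move: pA p0 pl; set p := param d x => pA p0 pl.
have l0 := len_gt0 d.1; set l := len d.1 in pl l0.
have [lp|lp] := ltP p l.
  (* The second point is taken towards the end l of the edge when p < l, and towards 0 otherwise; r
     / 2 keeps it strictly inside the ball. *)
  pose m := Num.min (r / 2) (l - p).
  have mr : m <= r / 2 by rewrite ge_min lexx.
  have ml : m <= l - p by rewrite ge_min lexx orbT.
  have m0 : 0 < m by rewrite lt_min subr_gt0 lp divr_gt0.
  exists (p + m); split => //; last by rewrite -subr_eq0 opprD addNKr oppr_eq0 gt_eqF.
  split; first by apply/andP; split; rewrite -/l; lra.
  by rewrite -/p addrAC subrr add0r gtr0_norm//; lra.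
pose m := Num.min (r / 2) p.
have mr : m <= r / 2 by rewrite ge_min lexx.
have mp : m <= p by rewrite ge_min lexx orbT.
have m0 : 0 < m by rewrite lt_min (lt_le_trans l0 lp) divr_gt0.
exists (p - m); split => //; last by rewrite -subr_eq0 opprB addrC subrK gt_eqF.
split; first by apply/andP; split; rewrite -/l; lra.
by rewrite -/p addrAC subrr add0r normrN gtr0_norm//; lra.
Qed.

(* The one-sided derivative into an edge is plus or minus the derivative with
   respect to its parameter, according to the orientation. *)
Lemma exit_limit (disp : measure_display) (T : measurableType disp)
    (P : probability T R) (Y : gpoint G -> T -> R) (v : vertex G) (d : dir G) :
  stems (Vertex v) d -> edgewise_Cn_at P 1 Y (Vertex v) ->
  exists W, ms_cvg P 0^'+
    (fun h => h^-1 *: (Y (along d (Vertex v) h) - Y (Vertex v))) W.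
Proof.
move=> xd /(_ d xd)[r r0] /= [g fg _].
set p := param d (Vertex v); pose s : R := if d.2 then 1 else -1.
have s2 : s * s = 1 by rewrite /s; case: ifP => _; rewrite ?mulrNN mulr1.
have sn h : `|s * h| = `|h|.
  by rewrite normrM /s; case: ifP => _; rewrite ?normrN normr1 mul1r.
have pA := edge_ball_center xd r0.
have pE : epoint d.1 p = Vertex v by exact: epoint_param.
have aE h : along d (Vertex v) h = epoint d.1 (p + s * h).
  by rewrite /along -/p /s; case: ifP => _; rewrite ?mul1r ?mulN1r.
have cphi : p + s * h @[h --> 0^'+] --> within (edge_ball (Vertex v) d r) p^'.
  move=> U [e /= e0 eU].
  (* A step shorter than the edge keeps the parameter in [0, [len d.1]]. *)
  exists (Num.min e (Num.min r (len d.1))); first by rewrite /= !lt_min e0 r0 len_gt0.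
  move=> h /=; rewrite sub0r normrN !lt_min => /and3P[he hr hl] h0.
  apply: eU => /=.
  - by rewrite opprD addNKr normrN sn.
  - by rewrite -subr_eq0 addrAC subrr add0r -normr_eq0 sn normr_eq0 gt_eqF.
  split; last by rewrite -/p addrAC subrr add0r sn.
  rewrite /p /s /=; rewrite gtr0_norm// in hl.
  by case: ifP => _; apply/andP; split; lra.
exists (s *: g p).
have H : ms_cvg P 0^'+ (fun h => s *: (fun w => (Y (epoint d.1 (p + s * h)) w
    - Y (epoint d.1 p) w) / (p + s * h - p))) (s *: g p).
  apply: ms_cvgZ; first exact: cvg_cst.
  exact: (ms_cvg_comp cphi (fg p pA)).
apply: ms_cvg_near H; near=> h; rewrite aE pE.
have h0 : h != 0 by rewrite gt_eqF.
have s0 : s != 0.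
  by apply/eqP => s0; move/eqP: s2; rewrite s0 mul0r eq_sym oner_eq0.
apply/funext => w.
rewrite -[LHS]/(s * ((Y (epoint d.1 (p + s * h)) w - Y (Vertex v) w) / (p + s * h - p))).
rewrite -[RHS]/(h^-1 * (Y (epoint d.1 (p + s * h)) w - Y (Vertex v) w)).
by rewrite addrAC subrr add0r; field; rewrite h0 s0.
Unshelve. all: by end_near. Qed.

End GraphPoints.

(** * Smoothness on the edges and Kirchhoff conditions at a vertex *)

Theorem theorem4p3 (R : realType) (G : metric_graph R)
  (d : measure_display) (T : measurableType d) (P : probability T R)
  (Z : gpoint G -> T -> R) (hZ : square_integrable P Z)
  (x : gpoint G) (k m : enat)
  (h1k : le_enat (Fin 1) k) (hkm : le_enat k m)
  (hZx : C_at P k m Z x)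
  (psi : R -> R) (hpsi : completely_monotone psi)
  (hnc : nonconstant psi) (hfin : finite_deriv0 psi m)
  (d' : measure_display) (T' : measurableType d') (P' : probability T' R)
  (Y : gpoint G -> T' -> R) (hY : is_Sch P P' psi Z Y) :
  C_at P' (Fin 1) m Y x.
Proof.
have [hZC hZK] := hZx.
have YL y : Y y \in Lfun P' 2%:E by exact: Sch_L2 hY y.
have cL y : center P (Z y) \in Lfun P 2%:E by apply: center_L2; exact: hZ.
have Yip y z : ip P' (Y y) (Y z) =
    psi (ip P (center P (Z y) - center P (Z z)) (center P (Z y) - center P (Z z))).
  by rewrite (Sch_ip hY) variogram_center.
have YC n : le_enat (Fin n) m -> edgewise_Cn_at P' n Y x.
  move=> nm e xe; have [r r0 ZCn] := hZC n nm e xe; exists r => //.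
  (* A finite limit of order m entails those of lower order; for infinite m every finite n is
     treated separately. *)
  have [l hl] := finite_deriv0_le hpsi hfin nm.
  apply: (@ms_Cn_Sch _ _ _ _ P _ P' _ hpsi (edge_ball x e r) n l
    (center P \o (fun t => Z (epoint e.1 t)))) => //.
  - exact: edge_ball_interval.
  - exact: edge_ball_nontrivial.
  - by move=> t _; exact: cL.
  - by apply: ms_Cn_center => // t _; exact: hZ.
split => // vx i; case: x vx hZx hZC hZK YC => [v|//] _ _ hZC hZK YC.
case: i => [|[|//]] _.
  (* Order 0: in every direction the exiting derivative is the value of Y at v. *)
  by exists (fun=> Y (Vertex v)); split => //; exact: aeW.
have [WZ [WZd WZ0]] := hZK I 1%N h1k.
have m1 := le_enat_trans h1k hkm.
have [l hl] := finite_deriv0_le hpsi hfin m1.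
have [WY WYd] : exists WY : dir G -> T' -> R, forall e, stems (Vertex v) e ->
    ms_cvg P' 0^'+ (fun h => h^-1 *: (Y (along e (Vertex v) h) - Y (Vertex v)))
      (WY e).
  have ex e : exists W, stems (Vertex v) e -> ms_cvg P' 0^'+
      (fun h => h^-1 *: (Y (along e (Vertex v) h) - Y (Vertex v))) W.
    have [xe|] := boolP (stems (Vertex v) e); last by exists 0.
    by have [W HW] := exit_limit xe (YC _ m1); exists W.
  by have [WY HWY] := choice ex; exists WY.
have WYL e : stems (Vertex v) e -> WY e \in Lfun P' 2%:E by move=> /WYd[].
have cZd e : stems (Vertex v) e -> ms_cvg P 0^'+ (fun h => h^-1 *:
    (center P (Z (along e (Vertex v) h)) - center P (Z (Vertex v))))
    (center P (WZ e)).
  move=> xe; have [V [V0 Vh cV]] := WZd e xe.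
  apply: ms_cvg_near (ms_cvg_center cV).
  (* A derivative of order 0 is the process itself, so the quotients defining [WZ e] are difference
     quotients of Z, and centring commutes with them. *)
  near=> h; have VE : V h = Z (along e (Vertex v) h) by near: h.
  have {}V0 : V 0 = Z (Vertex v) := V0.
  rewrite /= V0 VE -centerB; [|exact: hZ|exact: hZ].
  rewrite -centerZ; last by apply: L2B; exact: hZ.
  by congr center; apply/funext => w; rewrite [LHS]mulrC.
have WZL e : stems (Vertex v) e -> center P (WZ e) \in Lfun P 2%:E.
  by move=> /cZd[].
exists WY; split.
  move=> e xe; exists (fun h => Y (along e (Vertex v) h)); split.
  - rewrite /= /along; case: ifP => e2; rewrite ?addr0 ?subr0;
      by rewrite epoint_param.
  - exact: nearW.
  have a0 : along e (Vertex v) 0 = Vertex v.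
    by rewrite /along addr0 subr0 if_same epoint_param.
  apply: ms_cvg_near (WYd e xe); apply: nearW => h.
  by rewrite a0; apply/funext => w; rewrite [RHS]mulrC.
rewrite /=; pose S := \sum_(e | stems (Vertex v) e) WY e.
have SL : S \in Lfun P' 2%:E by apply: L2_sum.
suff S0 : ip P' S S = 0.
  have := ip_eq0_ae SL S0; apply: filterS => w.
  by rewrite /S fct_sumE.
pose S' := \sum_(e | stems (Vertex v) e) center P (WZ e).
(* Both squares expand into double sums over pairs of directions, matched term by term by
   [Sch_exit_ip]. *)
have -> : ip P' S S = - 2 * l * ip P S' S'.
  rewrite ip_sum_sum// ip_sum_sum// mulr_sumr; apply: eq_bigr => e xe.
  rewrite mulr_sumr; apply: eq_bigr => e' xe'.
  apply: (Sch_exit_ip hpsi hl _ _ _ _ _ _ _ _ _ _ (cZd e xe) (cZd e' xe')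
    (WYd e xe) (WYd e' xe')) => //.
  by rewrite Yip subrr ip0l.
have WL e : stems (Vertex v) e -> WZ e \in Lfun P 2%:E.
  by move=> /WZd[V [_ _ []]].
have S'E : S' = \sum_(e | stems (Vertex v) e) WZ e.
  (* The sum of the [WZ e] vanishes almost surely, so its mean is 0 and centring leaves it
     unchanged. *)
  rewrite /S' -center_sum// /center ip_ae0 ?scale0r ?subr0//.
  - exact: L2_sum.
  - exact: L2_1.
  - by apply: filterS WZ0 => w; rewrite fct_sumE.
rewrite (ip_ae0 _ _) ?mulr0//.
- by rewrite S'E; exact: L2_sum.
- by rewrite S'E; exact: L2_sum.
- by rewrite S'E; apply: filterS WZ0 => w; rewrite fct_sumE.
Unshelve. all: by end_near. Qed.
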